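(* Let $k\in\mathbb C$, $k\neq -3$. The Zhu algebra $A_{\overline\omega}(\mathcal W^k)$ of the universal Bershadsky-Polyakov vertex algebra $\mathcal W^k$ with respect to the conformal vector $\overline\omega=\omega+\frac12 DJ$ is a quotient of the Smith-type algebra $R(g)$ for $$g(x,y)=-(3x^2-(2k+3)x-(k+3)y).$$
   Context: For $k\in\mathbb C$, $k\ne -3$, $\mathcal W^k=\mathcal W^k(sl_3,f_\theta)$ is the universal Bershadsky-Polyakov vertex algebra of level $k$: the universal vertex algebra strongly generated by even fields $J,T,G^+,G^-$ with OPEs $J(z)J(w)\sim \frac{2k+3}{3}(z-w)^{-2}$, $G^\pm(z)G^\pm(w)\sim 0$, $J(z)G^\pm(w)\sim \pm G^\pm(w)(z-w)^{-1}$, $T(z)T(w)\sim \frac{c_k}{2}(z-w)^{-4}+2T(w)(z-w)^{-2}+DT(w)(z-w)^{-1}$, $T(z)G^\pm(w)\sim\frac32 G^\pm(w)(z-w)^{-2}+DG^\pm(w)(z-w)^{-1}$, $T(z)J(w)\sim J(w)(z-w)^{-2}+DJ(w)(z-w)^{-1}$, $G^+(z)G^-(w)\sim (k+1)(2k+3)(z-w)^{-3}+3(k+1)J(w)(z-w)^{-2}+\left(3:J(w)J(w):+\frac{3(k+1)}{2}DJ(w)-(k+3)T(w)\right)(z-w)^{-1}$, where $c_k=-\frac{(3k+1)(2k+3)}{k+3}$ and $D$ is the translation operator (derivative). Let $\omega$ be the conformal vector corresponding to $T$, with $T(z)=\sum L_nz^{-n-2}$, $J(z)=\sum J_nz^{-n-1}$.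 With respect to $\overline\omega=\omega+\frac12 DJ$, whose modes are $L(n)=L_n-\frac{n+1}{2}J_n$, $\mathcal W^k$ is $\mathbb Z_{\ge 0}$-graded by $L(0)$ and $J,G^+,G^-$ have weights $1,1,2$. For a $\mathbb Z_{\ge0}$-graded vertex operator algebra $V$ the Zhu algebra is $A(V)=V/O(V)$ with product $a*b=\mathrm{Res}_z\, Y(a,z)\frac{(1+z)^{\deg a}}{z}b$ and $O(V)$ spanned by $a\circ b=\mathrm{Res}_z\, Y(a,z)\frac{(1+z)^{\deg a}}{z^2}b$ ($a$ homogeneous); $A_{\overline\omega}$ means that degrees are taken with respect to $\overline\omega$. For $g(x,y)\in\mathbb C[x,y]$, $R(g)$ is the associative algebra generated by $E,F,X,Y$ with $Y$ central and relations $XE-EX=E$, $XF-FX=-F$, $EF-FE=g(X,Y)$. *)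

(* Defs.v *)
From HB Require Import structures.
From mathcomp Require Import all_boot all_order all_algebra.
From mathcomp Require Import boolp reals complex.
Set Implicit Arguments.
Unset Strict Implicit.
Unset Printing Implicit Defensive.
Import GRing.Theory Num.Theory.
Local Open Scope ring_scope.
Local Open Scope quotient_scope.

(** [algType] requires 1 != 0.  A quotient of an algebra may be zero, so an
    algebra over F is here a ring, possibly zero, with a ring morphism from F
    to its center. *)

Record pzAlgebra (F : fieldType) : Type := PzAlgebra {
  pza_ring :> pzRingType;
  pza_const : {rmorphism F -> pza_ring};
  pza_const_central : forall (c : F) (x : pza_ring),
    pza_const c * x = x * pza_const c
}.

Arguments pza_const {F} _.

Definition is_quotient_algebra (F : fieldType) (A B : pzAlgebra F) : Prop :=
  exists phi : {rmorphism A -> B},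
    (forall c : F, phi (pza_const A c) = pza_const B c) /\
    (forall y : B, exists x : A, phi x = y).

(** The Smith-type algebra R(g) is the quotient of the terms in E, F, X, Y by the
    least congruence that contains the algebra axioms and the defining relations.
    A polynomial g(x, y) is an element of {poly {poly F}}; as in [polyXY], the
    outer variable is x and the inner one is y. *)

Section Smith.
Variable F : fieldType.

Inductive smith_term : Type :=
| STE | STF | STX | STY
| STC of F
| STadd of smith_term & smith_term
| STmul of smith_term & smith_term.

Definition STsub s t := STadd s (STmul (STC (-1)) t).
Definition STexp t n := iter n (STmul t) (STC 1).

Definition smith_eval (g : {poly {poly F}}) : smith_term :=
  \big[STadd/STC 0]_(i < size g) \big[STadd/STC 0]_(j < size g`_i)
    STmul (STC g`_i`_j) (STmul (STexp STX i) (STexp STY j)).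

Inductive smith_cong (g : {poly {poly F}}) : smith_term -> smith_term -> Prop :=
| SC_refl t : smith_cong g t t
| SC_sym s t : smith_cong g s t -> smith_cong g t s
| SC_trans s t u : smith_cong g s t -> smith_cong g t u -> smith_cong g s u
| SC_add s s' t t' : smith_cong g s s' -> smith_cong g t t' ->
    smith_cong g (STadd s t) (STadd s' t')
| SC_mul s s' t t' : smith_cong g s s' -> smith_cong g t t' ->
    smith_cong g (STmul s t) (STmul s' t')
| SC_addA s t u : smith_cong g (STadd s (STadd t u)) (STadd (STadd s t) u)
| SC_addC s t : smith_cong g (STadd s t) (STadd t s)
| SC_add0 t : smith_cong g (STadd (STC 0) t) t
| SC_addN t : smith_cong g (STadd (STmul (STC (-1)) t) t) (STC 0)
| SC_mulA s t u : smith_cong g (STmul s (STmul t u)) (STmul (STmul s t) u)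
| SC_mul1 t : smith_cong g (STmul (STC 1) t) t
| SC_mulDl s t u :
    smith_cong g (STmul (STadd s t) u) (STadd (STmul s u) (STmul t u))
| SC_mulDr s t u :
    smith_cong g (STmul s (STadd t u)) (STadd (STmul s t) (STmul s u))
| SC_constD c d : smith_cong g (STC (c + d)) (STadd (STC c) (STC d))
| SC_constM c d : smith_cong g (STC (c * d)) (STmul (STC c) (STC d))
| SC_const_central c t : smith_cong g (STmul (STC c) t) (STmul t (STC c))
| SC_XE : smith_cong g (STsub (STmul STX STE) (STmul STE STX)) STE
| SC_XF : smith_cong g (STsub (STmul STX STF) (STmul STF STX))
                       (STmul (STC (-1)) STF)
| SC_EF : smith_cong g (STsub (STmul STE STF) (STmul STF STE)) (smith_eval g)
| SC_YE : smith_cong g (STmul STY STE) (STmul STE STY)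
| SC_YF : smith_cong g (STmul STY STF) (STmul STF STY)
| SC_YX : smith_cong g (STmul STY STX) (STmul STX STY).

HB.instance Definition _ := gen_eqMixin smith_term.
HB.instance Definition _ := gen_choiceMixin smith_term.

Section Quotient.
Variable g : {poly {poly F}}.

Definition smith_congb : rel smith_term := fun s t => `[< smith_cong g s t >].

Lemma smith_congb_refl : reflexive smith_congb.
Proof. by move=> t; apply/asboolP; exact: SC_refl. Qed.

Lemma smith_congb_sym : symmetric smith_congb.
Proof. by move=> s t; apply: asbool_equiv_eq; split; exact: SC_sym. Qed.

Lemma smith_congb_trans : transitive smith_congb.
Proof.
by move=> t s u /asboolP st /asboolP tu; apply/asboolP; exact: SC_trans st tu.
Qed.

Canonical smith_equiv :=
  EquivRel smith_congb smith_congb_refl smith_congb_sym smith_congb_trans.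

Definition smith_type : Type := {eq_quot smith_equiv}.
HB.instance Definition _ := Choice.on smith_type.

Definition smith_class (t : smith_term) : smith_type :=
  \pi_{eq_quot smith_equiv} t.
Definition smith_repr (x : smith_type) : smith_term :=
  repr (x : {eq_quot smith_equiv}).

Lemma smith_classP s t : smith_class s = smith_class t <-> smith_cong g s t.
Proof.
split; first by move/eqmodP/asboolP.
by move=> st; apply/eqmodP/asboolP.
Qed.

Lemma smith_reprK x : smith_class (smith_repr x) = x.
Proof. exact: reprK. Qed.

Lemma smith_repr_class t : smith_cong g (smith_repr (smith_class t)) t.
Proof. by apply/smith_classP; rewrite smith_reprK. Qed.

Lemma smith_ind (P : smith_type -> Prop) :
  (forall t, P (smith_class t)) -> forall x, P x.
Proof. by move=> Pc x; rewrite -(smith_reprK x). Qed.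

Definition smith_add x y := smith_class (STadd (smith_repr x) (smith_repr y)).
Definition smith_mul x y := smith_class (STmul (smith_repr x) (smith_repr y)).
Definition smith_opp x := smith_class (STmul (STC (-1)) (smith_repr x)).

Lemma smith_addE s t :
  smith_add (smith_class s) (smith_class t) = smith_class (STadd s t).
Proof. by apply/smith_classP; apply: SC_add; exact: smith_repr_class. Qed.

Lemma smith_mulE s t :
  smith_mul (smith_class s) (smith_class t) = smith_class (STmul s t).
Proof. by apply/smith_classP; apply: SC_mul; exact: smith_repr_class. Qed.

Lemma smith_oppE t : smith_opp (smith_class t) = smith_class (STmul (STC (-1)) t).
Proof.
by apply/smith_classP; apply: SC_mul; [exact: SC_refl|exact: smith_repr_class].
Qed.

Lemma smith_addA : associative smith_add.
Proof.
elim/smith_ind=> s; elim/smith_ind=> t; elim/smith_ind=> u.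
by rewrite !smith_addE; apply/smith_classP; exact: SC_addA.
Qed.

Lemma smith_addC : commutative smith_add.
Proof.
elim/smith_ind=> s; elim/smith_ind=> t.
by rewrite !smith_addE; apply/smith_classP; exact: SC_addC.
Qed.

Lemma smith_add0 : left_id (smith_class (STC 0)) smith_add.
Proof. by elim/smith_ind=> t; rewrite smith_addE; apply/smith_classP/SC_add0. Qed.

Lemma smith_addN : left_inverse (smith_class (STC 0)) smith_opp smith_add.
Proof.
elim/smith_ind=> t; rewrite smith_oppE smith_addE.
by apply/smith_classP; exact: SC_addN.
Qed.

HB.instance Definition _ :=
  GRing.isZmodule.Build smith_type smith_addA smith_addC smith_add0 smith_addN.

Lemma smith_mulA : associative smith_mul.
Proof.
elim/smith_ind=> s; elim/smith_ind=> t; elim/smith_ind=> u.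
by rewrite !smith_mulE; apply/smith_classP; exact: SC_mulA.
Qed.

Lemma smith_mul1l : left_id (smith_class (STC 1)) smith_mul.
Proof. by elim/smith_ind=> t; rewrite smith_mulE; apply/smith_classP/SC_mul1. Qed.

Lemma smith_mul1r : right_id (smith_class (STC 1)) smith_mul.
Proof.
elim/smith_ind=> t; rewrite smith_mulE; apply/smith_classP.
by apply: SC_trans (SC_mul1 _ t); apply: SC_sym; exact: SC_const_central.
Qed.

Lemma smith_mulDl : left_distributive smith_mul +%R.
Proof.
elim/smith_ind=> s; elim/smith_ind=> t; elim/smith_ind=> u.
rewrite /GRing.add /= !(smith_addE, smith_mulE).
by apply/smith_classP; exact: SC_mulDl.
Qed.

Lemma smith_mulDr : right_distributive smith_mul +%R.
Proof.
elim/smith_ind=> s; elim/smith_ind=> t; elim/smith_ind=> u.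
rewrite /GRing.add /= !(smith_addE, smith_mulE).
by apply/smith_classP; exact: SC_mulDr.
Qed.

HB.instance Definition _ := GRing.Zmodule_isPzRing.Build smith_type
  smith_mulA smith_mul1l smith_mul1r smith_mulDl smith_mulDr.

Definition smith_const (c : F) : smith_type := smith_class (STC c).

Lemma smith_const_zmod : zmod_morphism smith_const.
Proof.
move=> c d.
change (smith_const (c - d) =
        smith_add (smith_const c) (smith_opp (smith_const d))).
rewrite smith_oppE smith_addE.
apply/smith_classP; apply: SC_trans (SC_constD _ _ _) _.
apply: SC_add; first exact: SC_refl.
by rewrite -(mulN1r d); exact: SC_constM.
Qed.

Lemma smith_const_monoid : monoid_morphism smith_const.
Proof.
split=> // c d.
change (smith_const (c * d) = smith_mul (smith_const c) (smith_const d)).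
rewrite smith_mulE; by apply/smith_classP; exact: SC_constM.
Qed.

HB.instance Definition _ :=
  GRing.isZmodMorphism.Build F smith_type smith_const smith_const_zmod.
HB.instance Definition _ :=
  GRing.isMonoidMorphism.Build F smith_type smith_const smith_const_monoid.

Lemma smith_const_central c (x : smith_type) :
  smith_const c * x = x * smith_const c.
Proof.
elim/smith_ind: x => t; rewrite /GRing.mul /= !smith_mulE.
by apply/smith_classP; exact: SC_const_central.
Qed.

Definition smith_algebra : pzAlgebra F :=
  @PzAlgebra F smith_type smith_const smith_const_central.

End Quotient.
End Smith.

(** The binomial coefficient n (n - 1) ... (n - j + 1) / j! for an integer n. *)
Definition binz (F : fieldType) (n : int) (j : nat) : F :=
  (\prod_(i < j) (n - i%:Z)%:~R) / j`!%:R.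

(** [nprod n a b] is a_(n) b, where Y(a, z) = \sum_n a_(n) z^(- n - 1).
    The sums over j >= 0 in the Borcherds identity are finite: [nprod_borcherds]
    stops them at any N past which all three families of terms vanish. *)
Record vertexAlgebra (F : numFieldType) : Type := VertexAlgebra {
  va_carrier :> lmodType F;
  vac : va_carrier;
  nprod : int -> va_carrier -> va_carrier -> va_carrier;
  nprod_linearl : forall n b, linear (fun a => nprod n a b);
  nprod_linearr : forall n a, linear (nprod n a);
  nprod_trunc : forall a b,
    exists N : nat, forall n : nat, (N <= n)%N -> nprod n%:Z a b = 0;
  nprod_vacl : forall n b, nprod n vac b = if n == - 1 then b else 0;
  nprod_vacr : forall a, nprod (- 1) a vac = a;
  nprod_vacr0 : forall (n : nat) a, nprod n%:Z a vac = 0;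
  nprod_borcherds : forall (a b c : va_carrier) (m n k : int) (N : nat),
    (forall j : nat, (N <= j)%N ->
       [/\ nprod (n + j%:Z) a b = 0,
           nprod (k + j%:Z) b c = 0 &
           nprod (m + j%:Z) a c = 0]) ->
    \sum_(j < N) binz F m j *: nprod (m + k - j%:Z) (nprod (n + j%:Z) a b) c =
    \sum_(j < N) ((-1) ^+ j * binz F n j) *:
      (nprod (m + n - j%:Z) a (nprod (k + j%:Z) b c)
       - (-1) ^ n *: nprod (n + k - j%:Z) b (nprod (m + j%:Z) a c))
}.

Arguments vac {F} _.
Arguments nprod {F _} n a b.

Section VertexAlgebraTheory.
Variable F : numFieldType.

Definition va_deriv (V : vertexAlgebra F) (a : V) : V := nprod (- 2) a (vac V).

Definition va_morphism (V W : vertexAlgebra F) (f : V -> W) : Prop :=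
  [/\ linear f, f (vac V) = vac W &
      forall n a b, f (nprod n a b) = nprod n (f a) (f b)].

(** a(z) b(w) ~ \sum_j s_j(w) / (z - w)^(j + 1): [s] lists the coefficients of
    (z - w)^(-1), (z - w)^(-2), and so on. *)
Definition ope (V : vertexAlgebra F) (a b : V) (s : seq V) : Prop :=
  forall n : nat, nprod n%:Z a b = s`_n.

Definition in_span (V : lmodType F) (S : V -> Prop) (v : V) : Prop :=
  exists (n : nat) (c : 'I_n -> F) (s : 'I_n -> V),
    (forall i, S (s i)) /\ v = \sum_(i < n) c i *: s i.

Inductive strong_monomial (V : vertexAlgebra F) (S : V -> Prop) : V -> Prop :=
| strong_vac : strong_monomial S (vac V)
| strong_cons (a v : V) (n : nat) : S a -> strong_monomial S v ->
    strong_monomial S (nprod (- n.+1%:Z) a v).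

Definition strongly_generated (V : vertexAlgebra F) (S : V -> Prop) : Prop :=
  forall v : V, in_span (strong_monomial S) v.

Definition bp_central_charge (k : F) : F :=
  - ((3%:R * k + 1) * (2%:R * k + 3%:R) / (k + 3%:R)).

Record bp_ope (k : F) (V : vertexAlgebra F) (J T Gp Gm : V) : Prop := BpOpe {
  bp_JJ : ope J J [:: 0; ((2%:R * k + 3%:R) / 3%:R) *: vac V];
  bp_GpGp : ope Gp Gp [::];
  bp_GmGm : ope Gm Gm [::];
  bp_JGp : ope J Gp [:: Gp];
  bp_JGm : ope J Gm [:: - Gm];
  bp_TT : ope T T
    [:: va_deriv T; 2%:R *: T; 0; (bp_central_charge k / 2%:R) *: vac V];
  bp_TGp : ope T Gp [:: va_deriv Gp; (3%:R / 2%:R) *: Gp];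
  bp_TGm : ope T Gm [:: va_deriv Gm; (3%:R / 2%:R) *: Gm];
  bp_TJ : ope T J [:: va_deriv J; J];
  bp_GpGm : ope Gp Gm
    [:: 3%:R *: nprod (- 1) J J + (3%:R * (k + 1) / 2%:R) *: va_deriv J
          - (k + 3%:R) *: T;
        (3%:R * (k + 1)) *: J;
        ((k + 1) * (2%:R * k + 3%:R)) *: vac V]
}.

(** The morphism in [bp_universal] is unique, because W is generated by J, T, G+
    and G-.  Hence these conditions determine W up to a unique isomorphism. *)
Record is_universal_bp (k : F) (W : vertexAlgebra F) (J T Gp Gm : W) : Prop :=
  IsUniversalBp {
  bp_relations : bp_ope k J T Gp Gm;
  bp_generated : strongly_generated
    (fun a : W => [\/ a = J, a = T, a = Gp | a = Gm]);
  bp_universal : forall (V : vertexAlgebra F) (J' T' Gp' Gm' : V),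
    bp_ope k J' T' Gp' Gm' ->
    exists f : W -> V,
      va_morphism f /\ [/\ f J = J', f T = T', f Gp = Gp' & f Gm = Gm']
}.

(** The degree with respect to w is the eigenvalue of L(0) = w_(1). *)
Definition va_homog (V : vertexAlgebra F) (w : V) (n : nat) (a : V) : Prop :=
  nprod 1 w a = n%:R *: a.

Definition nat_graded (V : vertexAlgebra F) (w : V) : Prop :=
  forall v : V, in_span (fun a => exists n, va_homog w n a) v.

(** For a of degree d, [zhu_res d p a b] is Res_z Y(a, z) (1 + z)^d z^(- p) b:
    the coefficient of z^(-1) in \sum_(n, i) C(d, i) a_(n) z^(i - p - n - 1) b. *)
Definition zhu_res (V : vertexAlgebra F) (d p : nat) (a b : V) : V :=
  \sum_(i < d.+1) 'C(d, i)%:R *: nprod (i%:Z - p%:Z) a b.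

Definition zhu_star (V : vertexAlgebra F) (d : nat) (a b : V) : V :=
  zhu_res d 1 a b.

Definition zhu_circ (V : vertexAlgebra F) (d : nat) (a b : V) : V :=
  zhu_res d 2 a b.

Definition zhu_O (V : vertexAlgebra F) (w : V) : V -> Prop :=
  in_span (fun u => exists (d : nat) (a b : V),
                      va_homog w d a /\ u = zhu_circ d a b).

(** A model of A_w(V) = V / O(V), with its projection.  Homogeneous vectors span
    V when [nat_graded w] holds, so [zhu_classM] then determines the product
    and the model is unique up to a unique isomorphism.  The class of the vacuum
    is a left unit by [zhu_classM], hence it is 1. *)
Record zhu_algebra (V : vertexAlgebra F) (w : V) : Type := ZhuAlgebra {
  zhu_carrier :> pzAlgebra F;
  zhu_class : V -> zhu_carrier;
  zhu_classD : {morph zhu_class : u v / u + v};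
  zhu_classZ : forall (c : F) (v : V),
    zhu_class (c *: v) = pza_const zhu_carrier c * zhu_class v;
  zhu_class_surj : forall x : zhu_carrier, exists v : V, zhu_class v = x;
  zhu_class_ker : forall v : V, zhu_class v = 0 <-> zhu_O w v;
  zhu_classM : forall (d : nat) (a b : V), va_homog w d a ->
    zhu_class (zhu_star d a b) = zhu_class a * zhu_class b
}.

End VertexAlgebraTheory.

(** g(x, y) = - (3 x^2 - (2k + 3) x - (k + 3) y), with 'X for x and 'X%:P for y. *)
Definition bp_poly (F : fieldType) (k : F) : {poly {poly F}} :=
  - (3%:R *: 'X^2 - (2%:R * k + 3%:R)%:P *: 'X - (k + 3%:R)%:P *: 'X%:P).

(* Main.v *)
Require Import Defs.
From HB Require Import structures.
From mathcomp Require Import all_boot all_order all_algebra.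
From mathcomp Require Import boolp reals complex ring_quotient generic_quotient.
From mathcomp Require Import ring zify.
Set Implicit Arguments.
Unset Strict Implicit.
Unset Printing Implicit Defensive.
Import Order.TTheory GRing.Theory Num.Theory.
Local Open Scope ring_scope.

(** O(V) absorbs every residue of Y(a, z) (1 + z)^(deg a + n) z^(- 2 - m) b with
    n <= m.  Integrating the Borcherds identity against (1 + z)^A (1 + w)^B w^q
    (z - w)^n and discarding such residues shows, for suitable A, B, n, q, that
    O(V) is a two-sided ideal for the star product, that the product is
    associative modulo O(V), and that [a] [b] - [b] [a] is the class of
    \sum_j C(deg a - 1, j) a_(j) b.

    For the Bershadsky-Polyakov algebra put E = [G+], F = - [G-], X = [J] and
    Y = [omega_bar].  Since [D a] = - deg a [a], the commutator formula turns
    the OPEs into the relations of R(g), Y being central because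
    omega_bar_(0) a + omega_bar_(1) a = D a + deg a a.  By strong generation and
    induction on the degree, E, F, X and Y generate the Zhu algebra. *)

(** * Binomial sums *)

Section BinomialSums.
Variables (F : numFieldType) (V : lmodType F).
Implicit Types f : nat -> V.

(** With S the shift of sequences this is ((1 + S)^d f)(0): it stands for the factor (1 + z)^d under
    a residue. *)
Definition binsum d f : V := \sum_(i < d.+1) 'C(d, i)%:R *: f i.

Lemma eq_binsum d f g : f =1 g -> binsum d f = binsum d g.
Proof. by move=> fg; rewrite /binsum; apply: eq_bigr => i _; rewrite fg. Qed.

Lemma binsum0 f : binsum 0 f = f 0%N.
Proof. by rewrite /binsum big_ord1 scale1r. Qed.

Lemma binsumZ d x f : binsum d (fun i => x *: f i) = x *: binsum d f.
Proof.
by rewrite scaler_sumr; apply: eq_bigr => i _; rewrite !scalerA mulrC.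
Qed.

Lemma binsumB d f g : binsum d (fun i => f i - g i) = binsum d f - binsum d g.
Proof. by rewrite -sumrB; apply: eq_bigr => i _; rewrite scalerBr. Qed.

Lemma binsum_sum d I (r : seq I) (P : pred I) (f : I -> nat -> V) :
  binsum d (fun i => \sum_(j <- r | P j) f j i) =
  \sum_(j <- r | P j) binsum d (f j).
Proof.
by rewrite /binsum exchange_big; apply: eq_bigr => i _; rewrite scaler_sumr.
Qed.

Lemma binsum_exchange d e (f : nat -> nat -> V) :
  binsum d (fun i => binsum e (f i)) = binsum e (fun j => binsum d (f^~ j)).
Proof.
transitivity (\sum_(i < d.+1) binsum e (fun j => 'C(d, i)%:R *: f i j)).
  by apply: eq_bigr => i _; rewrite binsumZ.
by rewrite -binsum_sum.
Qed.

Lemma binsum_widen d N f : (d < N)%N ->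
  \sum_(i < N) 'C(d, i)%:R *: f i = binsum d f.
Proof.
move=> dN; rewrite /binsum (big_ord_widen N (fun i => 'C(d, i)%:R *: f i) dN).
rewrite [RHS]big_mkcond; apply: eq_bigr => i _.
by case: ltnP => // di; rewrite bin_small // scale0r.
Qed.

(** Pascal's rule, that is, (1 + z)^(d + 1) = (1 + z)^d + z (1 + z)^d. *)
Lemma binsumS d f : binsum d.+1 f = binsum d f + binsum d (fun i => f i.+1).
Proof.
rewrite -(@binsum_widen d d.+2) // [in LHS]/binsum.
rewrite big_ord_recl [in RHS]big_ord_recl /= !bin0 -addrA; congr (_ + _).
rewrite /binsum -big_split; apply: eq_bigr => i _ /=.
by rewrite /bump /= !add1n binS natrD scalerDl.
Qed.

(** This is (1 + z)^d (1 + z)^e = (1 + z)^(d + e). *)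
Lemma binsum_comp d e f :
  binsum d (fun r => binsum e (fun s => f (r + s)%N)) = binsum (d + e) f.
Proof.
elim: d f => [|d IH] f; first by rewrite binsum0.
by rewrite binsumS IH (IH (fun i => f i.+1)) -binsumS.
Qed.

(** Both sides equal A! / (j! r! (A - j - r)!), and both vanish when j + r > A. *)
Lemma bin_trinomial A j r :
  ('C(A, j + r) * 'C(j + r, j) = 'C(A, j) * 'C(A - j, r))%N.
Proof.
have [jrA|Ajr] := leqP (j + r) A; last first.
  rewrite bin_small // mul0n; have [Aj|jA] := ltnP A j.
    by rewrite bin_small.
  by rewrite (@bin_small (A - j)) ?muln0 // ltn_subLR.
have jA : (j <= A)%N by apply: leq_trans jrA; exact: leq_addr.
have rA : (r <= A - j)%N by rewrite leq_subRL.
have e1 := bin_fact jrA; have e2 := bin_fact (leq_addr r j).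
have e3 := bin_fact jA; have e4 := bin_fact rA.
rewrite addKn in e2; rewrite -subnDA in e4.
have p : (0 < j`! * r`! * (A - (j + r))`!)%N by rewrite !muln_gt0 !fact_gt0.
apply/eqP; rewrite -(eqn_pmul2r p); apply/eqP.
transitivity A`!.
  by rewrite -e1 -e2; ring.
by rewrite -e3 -e4; ring.
Qed.

(** The j-th derivative of (1 + z)^A divided by j! is C(A, j) (1 + z)^(A - j). *)
Lemma binsum_trinomial A j f :
  binsum A (fun r => 'C(r, j)%:R *: f (r - j)%N) =
  'C(A, j)%:R *: binsum (A - j) f.
Proof.
rewrite -(@binsum_widen A (j + A.+1)) ?leq_addl // big_split_ord /=.
rewrite big1 ?add0r; last first.
  by move=> i _; rewrite (bin_small (ltn_ord i)) scale0r scaler0.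
rewrite -(@binsum_widen (A - j) A.+1) ?ltnS ?leq_subr // scaler_sumr.
apply: eq_bigr => r _.
by rewrite addKn !scalerA -!natrM bin_trinomial.
Qed.

End BinomialSums.

(** * Binomial coefficients with an integer upper argument *)

Section GeneralizedBinomial.
Variable F : numFieldType.

Lemma binz0 n : binz F n 0 = 1.
Proof. by rewrite /binz big_ord0 fact0 divr1. Qed.

Lemma binzSr n j : j.+1%:R * binz F n j.+1 = (n - j%:Z)%:~R * binz F n j.
Proof.
rewrite /binz big_ord_recr /= factS natrM.
have : j.+1%:R != 0 :> F by rewrite pnatr_eq0.
have : j`!%:R != 0 :> F by rewrite pnatr_eq0 -lt0n fact_gt0.
by move: (_`!%:R) (_.+1%:R) => u v u0 v0; field; rewrite u0 v0.
Qed.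

Lemma binz_nat (n j : nat) : binz F n%:Z j = 'C(n, j)%:R.
Proof.
elim: j => [|j IH]; first by rewrite binz0 bin0.
have nz : j.+1%:R != 0 :> F by rewrite pnatr_eq0.
apply: (mulfI nz); rewrite binzSr IH -natrM mul_bin_left natrM.
have [jn|nj] := leqP j n; first by rewrite subzn.
by rewrite bin_small // !mulr0.
Qed.

Lemma binzSl n j : j.+1%:R * binz F (n + 1) j.+1 = (n + 1)%:~R * binz F n j.
Proof.
rewrite /binz big_ord_recl /= factS natrM subr0.
rewrite (eq_bigr (fun i : 'I_j => (n - i%:Z)%:~R)); last first.
  by move=> i _; congr (_%:~R); rewrite /bump /=; lia.
have : j.+1%:R != 0 :> F by rewrite pnatr_eq0.
have : j`!%:R != 0 :> F by rewrite pnatr_eq0 -lt0n fact_gt0.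
by move: (_`!%:R) (_.+1%:R) => u v u0 v0; field; rewrite u0 v0.
Qed.

Lemma binz1 n : binz F n 1 = n%:~R.
Proof. by have := binzSr n 0; rewrite mul1r binz0 mulr1 subr0. Qed.

Lemma binz0l j : binz F 0 j.+1 = 0.
Proof. by rewrite -[0]/(0%N%:Z) binz_nat. Qed.

Lemma binz1l j : binz F 1 j.+2 = 0.
Proof. by rewrite -[1]/(1%N%:Z) binz_nat. Qed.

Lemma binzS n j : binz F (n + 1) j.+1 = binz F n j.+1 + binz F n j.
Proof.
have nz : j.+1%:R != 0 :> F by rewrite pnatr_eq0.
apply: (mulfI nz); rewrite mulrDr binzSl (binzSr n) -mulrDl; congr (_ * _).
by rewrite pmulrn -intrD; congr (_%:~R); lia.
Qed.

(* Vandermonde's identity for r - 1 = r + (- 1), as C(- 1, i) = (- 1)^i. *)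
Lemma binz_pred (r : nat) j :
  binz F (r%:Z - 1) j = \sum_(i < j.+1) (-1) ^+ i * 'C(r, j - i)%:R.
Proof.
elim: j => [|j IH]; first by rewrite binz0 big_ord1 bin0 mulr1.
have -> : binz F (r%:Z - 1) j.+1 = 'C(r, j.+1)%:R - binz F (r%:Z - 1) j.
  have := binzS (r%:Z - 1) j; rewrite subrK binz_nat => ->.
  by rewrite addrK.
rewrite IH [RHS]big_ord_recl mul1r -sumrN.
congr (_ + _); apply: eq_bigr => i _.
by rewrite lift0 exprS subSS -mulrA mulN1r.
Qed.

End GeneralizedBinomial.

(** * The n-th products of a vertex algebra *)

HB.instance Definition _ (F : numFieldType) (V : vertexAlgebra F) n (a : V) :=
  GRing.isLinear.Build F V V *:%R (nprod n a) (nprod_linearr n a).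

Section NProducts.
Variables (F : numFieldType) (V : vertexAlgebra F).
Implicit Types a b c : V.

Definition nprodl n b a := nprod n a b : V.

HB.instance Definition _ n b :=
  GRing.isLinear.Build F V V *:%R (nprodl n b) (@nprod_linearl F V n b).

Lemma nprod0l n b : nprod n 0 b = 0 :> V.
Proof. exact: (linear0 (nprodl n b)). Qed.

Lemma nprodDl n a b c : nprod n (a + b) c = nprod n a c + nprod n b c.
Proof. exact: (linearD (nprodl n c)). Qed.

Lemma nprodZl n x a b : nprod n (x *: a) b = x *: nprod n a b.
Proof. exact: (linearZ_LR (nprodl n b)). Qed.

Lemma va_deriv_linear : linear (@va_deriv F V).
Proof. by move=> x a b; rewrite /va_deriv nprodDl nprodZl. Qed.

HB.instance Definition _ :=
  GRing.isLinear.Build F V V *:%R (@va_deriv F V) va_deriv_linear.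

Lemma nprod_truncz a b :
  exists N : nat, forall n : int, N%:Z <= n -> nprod n a b = 0.
Proof.
have [N trN] := nprod_trunc a b; exists N => -[n|n] //.
by rewrite lez_nat; exact: trN.
Qed.

(** The bound is uniform in r and s, so that the identities can be summed over r and s with binomial
    weights. *)
Lemma nprod_borcherds_eventually a b c (m n k : int) :
  exists N0, forall N, (N0 <= N)%N -> forall (r s : nat),
    \sum_(j < N) binz F (m + r%:Z) j *:
        nprod (m + r%:Z + (k + s%:Z) - j%:Z) (nprod (n + j%:Z) a b) c =
    \sum_(j < N) ((-1) ^+ j * binz F n j) *:
      (nprod (m + r%:Z + n - j%:Z) a (nprod (k + s%:Z + j%:Z) b c)
       - (-1) ^ n *: nprod (n + (k + s%:Z) - j%:Z) b
                       (nprod (m + r%:Z + j%:Z) a c)).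
Proof.
have [N1 tr1] := nprod_truncz a b; have [N2 tr2] := nprod_truncz b c.
have [N3 tr3] := nprod_truncz a c.
exists (maxn N1 (maxn N2 N3) + `|m| + `|n| + `|k|)%N => N leN r s.
by apply: nprod_borcherds => j Nj; split;
  [apply: tr1 | apply: tr2 | apply: tr3]; lia.
Qed.

(** The Borcherds identity with n = 0: as C(0, j) = 0 for j > 0, only j = 0 remains on its right
    side. *)
Lemma nprod_commutator a b c (m k : int) (N : nat) :
  (forall j : nat, (N <= j)%N -> nprod j%:Z a b = 0) ->
  nprod m a (nprod k b c) - nprod k b (nprod m a c) =
  \sum_(j < N) binz F m j *: nprod (m + k - j%:Z) (nprod j%:Z a b) c.
Proof.
move=> trab; have [N0 /(_ (maxn N0 N.+1) (leq_maxl _ _) 0%N 0%N)] :=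
  nprod_borcherds_eventually a b c m 0 k.
have /subnKC <- : (N.+1 <= maxn N0 N.+1)%N by exact: leq_maxr.
set M := (_ - _)%N => e.
transitivity (\sum_(j < N.+1 + M) ((-1) ^+ j * binz F 0 j) *:
   (nprod (m + 0 + 0 - j%:Z) a (nprod (k + 0 + j%:Z) b c)
    - (-1) ^ 0 *: nprod (0 + (k + 0) - j%:Z) b (nprod (m + 0 + j%:Z) a c))).
  rewrite addSn big_ord_recl big1 ?addr0 => [|j _]; last first.
    by rewrite binz0l mulr0 scale0r.
  by rewrite binz0 mulr1 !scale1r !(add0r, addr0, subr0).
rewrite -e !addr0 addSnnS big_split_ord /= [X in _ + X]big1 ?addr0; last first.
  by move=> j _; rewrite add0r trab ?leq_addr // nprod0l scaler0.
by apply: eq_bigr => j _; rewrite add0r.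
Qed.

Lemma nprod0_commutator a b c (k : int) :
  nprod 0 a (nprod k b c) = nprod k (nprod 0 a b) c + nprod k b (nprod 0 a c).
Proof.
have [N trN] := nprod_trunc a b.
apply/eqP; rewrite -subr_eq (@nprod_commutator _ _ _ _ _ N.+1); last first.
  by move=> j Nj; apply/trN/ltnW.
rewrite big_ord_recl big1 ?addr0 => [|j _].
  by rewrite binz0 scale1r add0r.
by rewrite binz0l scale0r.
Qed.

Lemma nprod1_commutator a b c (k : int) :
  nprod 1 a (nprod k b c) =
  nprod (k + 1) (nprod 0 a b) c + nprod k (nprod 1 a b) c
  + nprod k b (nprod 1 a c).
Proof.
have [N trN] := nprod_trunc a b.
apply/eqP; rewrite -subr_eq (@nprod_commutator _ _ _ _ _ N.+2); last first.
  by move=> j Nj; apply/trN/ltnW/ltnW.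
rewrite !big_ord_recl big1 ?addr0 => [|j _].
  by rewrite binz0 binz1 !scale1r (addrC 1 k) addrK.
by rewrite binz1l scale0r.
Qed.

(** The Borcherds identity for a, [vac], b with middle index - 2: its right side vanishes because
    only the mode - 1 of the vacuum is nonzero, and j = 0, 1 remain on the left. *)
Lemma nprod_deriv n a b : nprod n (va_deriv a) b = - n%:~R *: nprod (n - 1) a b.
Proof.
have [N0 /(_ (maxn N0 2) (leq_maxl _ _) 0%N 0%N)] :=
  nprod_borcherds_eventually a (vac V) b n (- 2) 0.
have /subnKC <- : (2 <= maxn N0 2)%N by exact: leq_maxr.
rewrite !addr0 [X in _ = X -> _]big1 => [|j _]; last first.
  by rewrite !nprod_vacl !ifF ?linear0 ?scaler0 ?subrr ?addr0 ?scaler0 //; lia.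
rewrite add2n !big_ord_recl big1 => [|j _]; last first.
  rewrite (_ : - 2 + _ = (j : nat)%:Z); first by rewrite nprod_vacr0
    nprod0l scaler0.
  by rewrite /= /bump /=; lia.
rewrite binz0 scale1r /= subr0 addr0 => /eqP; rewrite addr_eq0 => /eqP.
rewrite binz1.
by rewrite /bump /= addn0 nprod_vacr scaleNr addr0.
Qed.

(** The Borcherds identity for a, b, [vac] with m = 0 and k = - 2; the term j = 1 on its right, - n
    a_(n - 1) b, is (D a)_(n) b. *)
Lemma deriv_nprod n a b :
  va_deriv (nprod n a b) = nprod n (va_deriv a) b + nprod n a (va_deriv b).
Proof.
have [N0 /(_ (maxn N0 2) (leq_maxl _ _) 0%N 0%N)] :=
  nprod_borcherds_eventually a b (vac V) 0 n (- 2).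
have /subnKC <- : (2 <= maxn N0 2)%N by exact: leq_maxr.
rewrite !addr0 !add0r.
rewrite add2n [X in X = _ -> _]big_ord_recl big1 => [|j _]; last first.
  by rewrite binz0l scale0r.
rewrite binz0 scale1r subr0 !addr0 => e; rewrite [LHS]e {e}.
rewrite !big_ord_recl big1 => [|j _]; last first.
  rewrite (_ : - 2 + _ = (j : nat)%:Z); last by rewrite /= /bump /=; lia.
  by rewrite add0r !nprod_vacr0 !linear0 addr0 !scaler0.
rewrite !add0r !nprod_vacr0 !(scaler0, linear0) !addr0 binz0 mulr1 scale1r.
rewrite addrC; congr (_ + _); rewrite nprod_deriv binz1.
by rewrite /bump /= expr1 mulN1r nprod_vacr.
Qed.

End NProducts.

(** * Residues and the Borcherds identity *)

Section Residues.
Variables (F : numFieldType) (V : vertexAlgebra F).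
Implicit Types a b c : V.

(* The residue of Y(a, z) (1 + z)^d z^q b. *)
Definition gres d (q : int) a b : V := binsum d (fun i => nprod (i%:Z + q) a b).

Lemma gresE d q a b :
  gres d q a b = \sum_(i < d.+1) 'C(d, i)%:R *: nprod (i%:Z + q) a b.
Proof. by []. Qed.

Lemma zhu_resE d p a b : zhu_res d p a b = gres d (- p%:Z) a b.
Proof. by []. Qed.

Lemma gres_linear d q a : linear (gres d q a).
Proof.
move=> x b c; rewrite !gresE scaler_sumr -big_split; apply: eq_bigr => i _.
by rewrite linearP scalerDr !scalerA mulrC.
Qed.

HB.instance Definition _ d q a :=
  GRing.isLinear.Build F V V *:%R (gres d q a) (gres_linear d q a).

Lemma gresS d q a b : gres d.+1 q a b = gres d q a b + gres d (q + 1) a b.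
Proof.
rewrite /gres binsumS; congr (_ + _); apply: eq_binsum => i.
by congr nprod; lia.
Qed.

Lemma gres_comp d e q a b :
  binsum d (fun r => gres e (q + r%:Z) a b) = gres (d + e) q a b.
Proof.
rewrite /gres -binsum_comp; apply: eq_binsum => r; apply: eq_binsum => s.
by congr nprod; lia.
Qed.

Lemma gres_gres A p B q a b c :
  gres A p a (gres B q b c) =
  binsum A (fun r => binsum B (fun s =>
    nprod (r%:Z + p) a (nprod (s%:Z + q) b c))).
Proof.
by apply: eq_binsum => r; rewrite /gres /binsum linear_sum;
  under eq_bigr do rewrite linearZ.
Qed.

Lemma gres_gres_swap A p B q a b c :
  gres B q b (gres A p a c) =
  binsum A (fun r => binsum B (fun s =>
    nprod (s%:Z + q) b (nprod (r%:Z + p) a c))).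
Proof. by rewrite gres_gres binsum_exchange. Qed.

(** C(r, d) w^(r - d) is the coefficient of (z - w)^d in z^r; summing over r gives the one in (1 +
    z)^A. *)
Lemma binsum_gres d e A q n a b c :
  binsum A (fun r => 'C(r, d)%:R *:
    gres e (q + r%:Z - d%:Z) (nprod n a b) c) =
  'C(A, d)%:R *: gres (A - d + e) q (nprod n a b) c.
Proof.
rewrite -gres_comp -(binsum_trinomial A d (fun r => gres e (q + r%:Z) _ c)).
apply: eq_binsum => r; have [rd|dr] := ltnP r d.
  by rewrite bin_small // !scale0r.
by congr (_ *: gres _ _ _ _); rewrite -subzn // addrA.
Qed.

(* The Borcherds identity integrated against
   (1 + z)^A (1 + w)^B w^q (z - w)^n. *)
Lemma gres_borcherds A B (n q : int) a b c :
  exists N0, forall N, (N0 <= N)%N ->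
  \sum_(j < N) 'C(A, j)%:R *: gres (A - j + B) q (nprod (n + j%:Z) a b) c =
  \sum_(j < N) ((-1) ^+ j * binz F n j) *:
    (gres A (n - j%:Z) a (gres B (q + j%:Z) b c)
     - (-1) ^ n *: gres B (n + q - j%:Z) b (gres A j%:Z a c)).
Proof.
have [N0 bor] := nprod_borcherds_eventually a b c 0 n q.
exists N0 => N /bor {}bor.
(* These are the identities for the monomials z^r w^(q + s), weighted by C(A, r) C(B, s). *)
transitivity (binsum A (fun r => binsum B (fun s =>
  \sum_(j < N) binz F (0 + r%:Z) j *:
    nprod (0 + r%:Z + (q + s%:Z) - j%:Z) (nprod (n + j%:Z) a b) c))).
  under eq_bigr do rewrite -binsum_gres.
  rewrite exchange_big; apply: eq_bigr => r _ /=.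
  rewrite -scaler_sumr; congr (_ *: _).
  rewrite /gres; under eq_bigr do rewrite scaler_sumr.
  rewrite exchange_big; apply: eq_bigr => s _ /=.
  rewrite scaler_sumr; apply: eq_bigr => j _.
  rewrite add0r binz_nat !scalerA mulrC; congr (_ *: nprod _ _ _).
  by lia.
transitivity (binsum A (fun r => binsum B (fun s =>
  \sum_(j < N) ((-1) ^+ j * binz F n j) *:
    (nprod (0 + r%:Z + n - j%:Z) a (nprod (q + s%:Z + j%:Z) b c)
    - (-1) ^ n *: nprod (n + (q + s%:Z) - j%:Z) b
                   (nprod (0 + r%:Z + j%:Z) a c))))).
  by apply: eq_binsum => r; apply: eq_binsum => s; exact: bor.
under eq_binsum do rewrite binsum_sum; rewrite binsum_sum.
apply: eq_bigr => j _.
under eq_binsum do rewrite binsumZ binsumB binsumZ.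
rewrite binsumZ binsumB binsumZ gres_gres gres_gres_swap.
by congr (_ *: (_ - _ *: _)); apply: eq_binsum => r; apply: eq_binsum => s;
  congr (nprod _ _ (nprod _ _ _)); lia.
Qed.

End Residues.

(** * The subspace O(V) *)

Section LinearSpan.
Variables (F : numFieldType) (V : lmodType F) (S : V -> Prop).

Lemma in_span_gen v : S v -> in_span S v.
Proof.
move=> Sv; exists 1%N, (fun=> 1), (fun=> v).
by rewrite big_ord1 scale1r.
Qed.

Lemma in_span0 : in_span S 0.
Proof.
by exists 0%N, (fun=> 0), (fun=> 0); rewrite big_ord0; split=> // -[].
Qed.

Lemma in_spanD u v : in_span S u -> in_span S v -> in_span S (u + v).
Proof.
move=> [n [c [s [Ss ->]]]] [m [d [t [St ->]]]].
exists (n + m)%N, (fun i => match split i with inl j => c j | inr j => d j end),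
  (fun i => match split i with inl j => s j | inr j => t j end).
split=> [i|]; first by case: (split i).
rewrite big_split_ord /=; congr (_ + _); apply: eq_bigr => i _.
  by rewrite -[lshift _ _]/(unsplit (inl _)) unsplitK.
by rewrite -[rshift _ _]/(unsplit (inr _)) unsplitK.
Qed.

Lemma in_spanZ x v : in_span S v -> in_span S (x *: v).
Proof.
move=> [n [c [s [Ss ->]]]]; exists n, (fun i => x * c i), s; split=> //.
by rewrite scaler_sumr; apply: eq_bigr => i _; rewrite scalerA.
Qed.

Lemma in_spanN v : in_span S v -> in_span S (- v).
Proof. by rewrite -scaleN1r; exact: in_spanZ. Qed.

Lemma in_spanB u v : in_span S u -> in_span S v -> in_span S (u - v).
Proof. by move=> Su Sv; apply: in_spanD => //; exact: in_spanN. Qed.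

Lemma in_span_sum I (r : seq I) (P : pred I) (f : I -> V) :
  (forall i, P i -> in_span S (f i)) -> in_span S (\sum_(i <- r | P i) f i).
Proof.
by move=> Sf; apply: big_ind => //; [exact: in_span0|exact: in_spanD].
Qed.

Lemma in_span_min (P : V -> Prop) : P 0 ->
  (forall x u v, S u -> P v -> P (x *: u + v)) -> forall v, in_span S v -> P v.
Proof.
move=> P0 PD _ [n [c [s [Ss ->]]]].
by elim/big_rec: _ => // i v _; exact: PD.
Qed.

End LinearSpan.

(** * The grading, and residues that lie in O(V) *)

Section GradedVertexAlgebra.
Variables (F : numFieldType) (V : vertexAlgebra F) (w : V).
Hypothesis translation : forall a, nprod 0 w a = va_deriv a.
Implicit Types a b c : V.

Lemma va_homogZ d x a : va_homog w d a -> va_homog w d (x *: a).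
Proof. by rewrite /va_homog linearZ /= => ->; rewrite !scalerA mulrC. Qed.

Lemma va_homogD d a b :
  va_homog w d a -> va_homog w d b -> va_homog w d (a + b).
Proof. by rewrite /va_homog linearD scalerDr /= => -> ->. Qed.

Lemma va_homog_vac : va_homog w 0 (vac V).
Proof. by rewrite /va_homog scale0r (nprod_vacr0 1). Qed.

(** The commutator of w_(1) with a_(n) is (D a)_(n + 1) + (w_(1) a)_(n), which adds deg a - n - 1 to
    the degree. *)
Lemma va_homog_nprod d e t n a b : va_homog w d a -> va_homog w e b ->
  d%:Z + e%:Z = t%:Z + n + 1 -> va_homog w t (nprod n a b).
Proof.
move=> ha hb det; rewrite /va_homog nprod1_commutator translation nprod_deriv.
rewrite addrK ha hb nprodZl linearZ -!scalerDl; congr (_ *: _).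
by rewrite !pmulrn -mulrNz -!intrD; congr (_%:~R); lia.
Qed.

Lemma va_homog_deriv d a : va_homog w d a -> va_homog w d.+1 (va_deriv a).
Proof. by move=> ha; apply: va_homog_nprod ha va_homog_vac _; lia. Qed.

(* Y(D a, z) is the derivative of Y(a, z): integrate by parts against
   (1 + z)^(d + 1) z^(- 2 - m). *)
Lemma gres_circ_step d m a b :
  (m%:Z + 2)%:~R *: gres d (- 3%:Z - m%:Z) a b =
  gres d.+1 (- 2%:Z - m%:Z) (va_deriv a) b +
  (d%:Z - 1 - m%:Z)%:~R *: gres d (- 2%:Z - m%:Z) a b.
Proof.
have e : gres d.+1 (- 2%:Z - m%:Z) (va_deriv a) b =
    (m%:Z + 2)%:~R *: gres d.+1 (- 3%:Z - m%:Z) a b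
    - d.+1%:R *: gres d (- 2%:Z - m%:Z) a b.
  rewrite !gresE [X in _ = _ - _ *: X](_ : _ =
    \sum_(i < d.+1) 'C(d, i)%:R *: nprod ((i.+1)%:Z - 3%:Z - m%:Z) a b);
      last first.
    by apply: eq_bigr => i _; congr (_ *: nprod _ _ _); lia.
  rewrite scaler_sumr [X in _ = _ - X]scaler_sumr.
  have -> : \sum_(i < d.+1) d.+1%:R *:
       ('C(d, i)%:R *: nprod (i.+1%:Z - 3%:Z - m%:Z) a b) =
     \sum_(i < d.+2) (i%:R * 'C(d.+1, i)%:R) *: nprod (i%:Z - 3%:Z - m%:Z) a b.
    rewrite [RHS]big_ord_recl mul0r scale0r add0r; apply: eq_bigr => i _.
    by rewrite scalerA -!natrM lift0 -mul_bin_diag.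
  rewrite -sumrB; apply: eq_bigr => i _; rewrite nprod_deriv.
  rewrite (_ : i%:Z + (- 2%:Z - m%:Z) - 1 = i%:Z - 3%:Z - m%:Z); last by lia.
  rewrite (_ : i%:Z + (- 3%:Z - m%:Z) = i%:Z - 3%:Z - m%:Z); last by lia.
  rewrite !scalerA -scalerBl; congr (_ *: _).
  by rewrite pmulrn !(intrD, rmorphN) /= -!pmulrn; ring.
(* After (1 + z)^(d + 1) = (1 + z)^d + z (1 + z)^d the coefficients (m + 2) - (d + 1) + (d - 1 - m)
   cancel. *)
rewrite e gresS (_ : - 3%:Z - m%:Z + 1 = - 2%:Z - m%:Z); last by lia.
rewrite scalerDr -!addrA -[LHS]addr0; congr (_ + _).
rewrite -scaleNr -!scalerDl -[LHS](scale0r (gres d (- 2%:Z - m%:Z) a b)).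
congr (_ *: _).
by rewrite [d.+1%:R]pmulrn -mulrNz -!intrD -[0]/((0:int)%:~R); congr (_%:~R);
  lia.
Qed.

Local Notation O := (zhu_O w).

(** Induction on m by [gres_circ_step], where m + 2 is invertible; d and a vary in the induction
    because D a has degree d + 1. *)
Lemma gres_circ d m a b : va_homog w d a -> O (gres d (- 2%:Z - m%:Z) a b).
Proof.
elim: m d a => [|m IH] d a ha.
  by rewrite subr0; apply: in_span_gen; exists d, a, b.
have nz : (m%:Z + 2)%:~R != 0 :> F by rewrite intr_eq0; lia.
rewrite (_ : - 2%:Z - m.+1%:Z = - 3%:Z - m%:Z); last by lia.
rewrite -[gres _ _ _ _](scalerK nz) gres_circ_step; apply: in_spanZ.
apply: in_spanD; last by apply: in_spanZ; exact: IH.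
by apply: IH; exact: va_homog_deriv.
Qed.

(** Each factor 1 + z splits into 1 and z; a factor z raises the exponent - 2 - m by one, and n <= m
    keeps it at most - 2. *)
Lemma gres_circ_le d n m a b : (n <= m)%N -> va_homog w d a ->
  O (gres (d + n) (- 2%:Z - m%:Z) a b).
Proof.
move=> + ha; elim: n m => [|n IH] m nm; first by rewrite addn0;
  exact: gres_circ.
rewrite addnS gresS; apply: in_spanD; first by apply: IH; exact: ltnW.
case: m nm => // m nm; rewrite (_ : _ + 1 = - 2%:Z - m%:Z); last by lia.
exact: IH.
Qed.

(** Splitting one factor 1 + z leaves (1 + z)^i z^(- 2 - i), whose residue is in O(V), and (1 + z)^i
    z^(- 1 - i), which is the case of i - 1, or the star product if i = 0. *)
Lemma gres_star_mod d i a b : va_homog w d a ->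
  O (gres (d + i.+1) (- 2%:Z - i%:Z) a b - gres d (- 1) a b).
Proof.
move=> ha; elim: i => [|i IH].
  rewrite addn1 gresS (_ : _ + 1 = -1) // -addrA subrr addr0.
  by exact: gres_circ.
rewrite addnS gresS (_ : _ + 1 = - 2%:Z - i%:Z); last by lia.
by rewrite -addrA; apply: in_spanD; [exact: gres_circ_le|].
Qed.

(** The left sum stops at A since C(A, j) = 0 beyond; the bound N + 1 lets j = 0 be split off on the
    right. *)
Lemma gres_borcherds_head A B (n q : int) a b c :
  exists N : nat,
  binsum A (fun j => gres (A - j + B) q (nprod (n + j%:Z) a b) c) =
  \sum_(j < N.+1) ((-1) ^+ j * binz F n j) *:
    (gres A (n - j%:Z) a (gres B (q + j%:Z) b c)
     - (-1) ^ n *: gres B (n + q - j%:Z) b (gres A j%:Z a c)).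
Proof.
have [N0 e] := gres_borcherds A B n q a b c; exists (N0 + A)%N.
rewrite -(@binsum_widen _ _ A (N0 + A).+1) ?ltnS ?leq_addl //.
by apply: e; rewrite leqW // leq_addr.
Qed.

(* The Borcherds identity with n = - 1.  In the expansion of (z - w)^(- 1), all
   terms but the first put z^(- 2 - j) on a or w^(- 2 - m - j) on b, hence lie
   in O(V).  For m = 0 this is associativity, for m = 1 it makes O(V) a left
   ideal. *)
Lemma gres_assoc d e m a b c : va_homog w d a -> va_homog w e b ->
  O (binsum d (fun j => gres (d - j + e) (- 1 - m%:Z) (nprod (j%:Z - 1) a b) c)
     - gres d (- 1) a (gres e (- 1 - m%:Z) b c)).
Proof.
move=> ha hb; have [N eN] := gres_borcherds_head d e (- 1) (- 1 - m%:Z) a b c.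
under eq_binsum => j do rewrite [j%:Z - _]addrC.
rewrite {}eN big_ord_recl mul1r binz0 scale1r subr0 addr0.
rewrite addrAC [X in O (X + _)]addrAC subrr sub0r; apply: in_spanD.
  apply: in_spanN; apply: in_spanZ.
  by rewrite [X in gres _ X](_ : _ = - 2%:Z - m%:Z);
    [exact: gres_circ|rewrite /=; lia].
apply: in_span_sum => j _; apply: in_spanZ; apply: in_spanB.
  by rewrite lift0 [X in gres _ X](_ : _ = - 2%:Z - j%:Z);
    [exact: gres_circ|lia].
apply: in_spanZ; rewrite lift0 [X in gres _ X](_ : _ = - 2%:Z - (m + j.+1)%:Z);
  last by lia.
exact: gres_circ.
Qed.

(* The Borcherds identity with n = - 2.  The exponent e + 1 on b, one more than
   its degree, turns the sum into the star product of zhu_circ d a b with c. *)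
Lemma gres_circ_star d e a b c : va_homog w d a -> va_homog w e b ->
  O (binsum d (fun j => gres (d - j + e.+1) (- 1) (nprod (j%:Z - 2%:Z) a b) c)).
Proof.
move=> ha hb; have [N eN] := gres_borcherds_head d e.+1 (- 2%:Z) (- 1) a b c.
under eq_binsum => j do rewrite [j%:Z - _]addrC.
rewrite {}eN; apply: in_span_sum => j _; apply: in_spanZ; apply: in_spanB.
  exact: gres_circ.
apply: in_spanZ; rewrite [X in gres _ X](_ : _ = - 2%:Z - j.+1%:Z); last by lia.
(* The exponent - 3 - j of w has one order to spare for the extra factor 1 + w. *)
by rewrite -addn1; apply: gres_circ_le.
Qed.

End GradedVertexAlgebra.

Lemma gres_vac (F : numFieldType) (V : vertexAlgebra F) d (a : V) :
  gres d (- 1) a (vac V) = a.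
Proof.
rewrite gresE big_ord_recl bin0 scale1r nprod_vacr big1 ?addr0 // => i _.
rewrite (_ : _ + _ = i%:Z) ?nprod_vacr0 ?scaler0 //.
by rewrite lift0; lia.
Qed.

(** * The star product *)

Section ZhuAlgebra.
Variables (F : numFieldType) (V : vertexAlgebra F) (w : V).
Hypothesis translation : forall a, nprod 0 w a = va_deriv a.
Implicit Types a b c : V.
Local Notation O := (zhu_O w).

(* Expanding z^(- 1) around w gives factors (1 + w)^(D + i + 1) w^(- 2 - i), with
   D the degree of a_(j) b; these are congruent to (1 + w)^D w^(- 1) modulo
   O(V). *)
Lemma gres_commutator d e N a b c : va_homog w d a -> va_homog w e b ->
  (forall j : nat, (N <= j)%N -> nprod j%:Z a b = 0) -> (N <= d + e)%N ->
  O (gres d (- 1) a (gres e (- 1) b c) - gres e (- 1) b (gres d (- 1) a c)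
     - \sum_(j < N) binz F (d%:Z - 1) j *:
         gres ((d + e).-1 - j) (- 1) (nprod j%:Z a b) c).
Proof.
move=> ha hb abN leN; rewrite gres_gres gres_gres_swap -binsumB.
under eq_binsum => r do (rewrite -binsumB;
  under eq_binsum => s do rewrite (nprod_commutator _ _ _ abN);
  rewrite binsum_sum; under eq_bigr => j _ do rewrite binsumZ).
rewrite binsum_sum -sumrB; apply: in_span_sum => j _.
have -> : binsum d (fun r => binz F (r%:Z - 1) j *: binsum e (fun s =>
     nprod (r%:Z - 1 + (s%:Z - 1) - j%:Z) (nprod j%:Z a b) c)) =
   \sum_(i < j.+1) ((-1) ^+ i * 'C(d, j - i)%:R) *:
     gres (d - (j - i) + e) (- 2%:Z - i%:Z) (nprod j%:Z a b) c.
  under eq_bigr => i _ do rewrite -scalerA -binsum_gres -binsumZ.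
  rewrite -binsum_sum; apply: eq_binsum => r.
  rewrite binz_pred scaler_suml; apply: eq_bigr => i _.
  rewrite !scalerA; congr (_ *: _); apply: eq_binsum => s.
  by congr nprod; have := ltn_ord i; lia.
(* C(d - 1, j) expands by the same formula, so the two sums are compared term by term in i. *)
rewrite binz_pred scaler_suml -sumrB; apply: in_span_sum => i _.
rewrite -scalerBr; have [dji|jid] := ltnP d (j - i).
  by rewrite bin_small // mulr0 scale0r; exact: in_span0.
apply: in_spanZ; have := ltn_ord i; have := ltn_ord j => jN ij.
(* As a_(j) b has degree d + e - 1 - j, the excess exponent is the i + 1 of [gres_star_mod]. *)
rewrite (_ : d - (j - i) + e = (d + e).-1 - j + i.+1)%N; last by lia.
apply: gres_star_mod => //; apply: va_homog_nprod ha hb _ => //.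
by lia.
Qed.

Hypothesis graded : nat_graded w.

(* The operator C(L(0), i).  It makes the star product linear in its first
   argument without splitting that argument into homogeneous parts. *)
Fixpoint degbin i a : V :=
  if i is j.+1 then
    j.+1%:R^-1 *: (nprod 1 w (degbin j a) - j%:R *: degbin j a)
  else a.

Lemma degbin_linear i : linear (degbin i).
Proof.
elim: i => [|i IH] x a b //=; rewrite !IH linearP.
rewrite [X in _ = X + _]scalerA (mulrC x) -scalerA -scalerDr; congr (_ *: _).
by rewrite scalerBr scalerDr !scalerA (mulrC x) opprD addrACA.
Qed.

HB.instance Definition _ i :=
  GRing.isLinear.Build F V V *:%R (degbin i) (degbin_linear i).

Lemma degbin_homog d i a : va_homog w d a -> degbin i a = 'C(d, i)%:R *: a.
Proof.
move=> ha; elim: i => [|i IH] /=; first by rewrite bin0 scale1r.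
rewrite IH linearZ /= ha !scalerA -scalerBl scalerA; congr (_ *: _).
have nz : i.+1%:R != 0 :> F by rewrite pnatr_eq0.
apply: (mulfI nz); rewrite mulVKf // -!binz_nat binzSr.
by rewrite intrD mulrNz -!pmulrn; ring.
Qed.

Lemma degbin_eventually0 a :
  exists N, forall i, (N <= i)%N -> degbin i a = 0.
Proof.
elim/in_span_min: (graded a) => [|x u v [d hu] [N IH]].
  by exists 0%N => i _; rewrite linear0.
exists (maxn d.+1 N) => i; rewrite geq_max => /andP[di Ni].
by rewrite linearP /= (degbin_homog _ hu) bin_small // scale0r scaler0 add0r IH.
Qed.

Definition degbin_bound a := projT1 (cid (degbin_eventually0 a)).

(** This is Res_z Y((1 + z)^L(0) a, z) z^(- 1) b, which makes sense for every a and is [zhu_star]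
    for homogeneous a. *)
Definition star a b : V :=
  \sum_(i < degbin_bound a) nprod (i%:Z - 1) (degbin i a) b.

(** Terms past a valid bound vanish, so two vectors can be given a common bound when linearity in a
    is proved. *)
Lemma starE N a b : (forall i, (N <= i)%N -> degbin i a = 0) ->
  star a b = \sum_(i < N) nprod (i%:Z - 1) (degbin i a) b.
Proof.
rewrite /star /degbin_bound; case: cid => M /= aM aN.
pose f i := nprod (i%:Z - 1) (degbin i a) b.
have f0 K L : (forall i, (K <= i)%N -> degbin i a = 0) ->
    \sum_(i < K) f i = \sum_(i < K + L) f i.
  move=> aK; rewrite big_split_ord /= [X in _ + X]big1 ?addr0 // => i _.
  by rewrite /f aK ?leq_addr // nprod0l.
have [MN|/ltnW NM] := leqP M N; [rewrite -(subnKC MN)|rewrite -(subnKC NM)].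
  exact: f0.
by apply/esym/f0.
Qed.

Lemma star_homog d a b : va_homog w d a -> star a b = gres d (- 1) a b.
Proof.
move=> ha; rewrite (@starE d.+1) => [|i di]; last first.
  by rewrite (degbin_homog _ ha) bin_small // scale0r.
by apply: eq_bigr => i _; rewrite (degbin_homog _ ha) nprodZl.
Qed.

Lemma star_linearr a : linear (star a).
Proof.
move=> x b c; rewrite scaler_sumr -big_split; apply: eq_bigr => i _ /=.
by rewrite linearP.
Qed.

HB.instance Definition _ a :=
  GRing.isLinear.Build F V V *:%R (star a) (star_linearr a).

Definition starl b a := star a b.

Lemma starl_linear b : linear (starl b).
Proof.
move=> x a c; rewrite /starl.
have [N Na] := degbin_eventually0 a; have [M Mc] := degbin_eventually0 c.
rewrite !(@starE (maxn N M)); first last.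
- by move=> i; rewrite geq_max => /andP[/Na Ni /Mc Mi];
    rewrite linearP /= Ni Mi scaler0 addr0.
- by move=> i; rewrite geq_max => /andP[/Na].
- by move=> i; rewrite geq_max => /andP[_ /Mc].
rewrite scaler_sumr -big_split; apply: eq_bigr => i _ /=.
by rewrite linearP nprodDl nprodZl.
Qed.

HB.instance Definition _ b :=
  GRing.isLinear.Build F V V *:%R (starl b) (starl_linear b).

Lemma starDl a b c : star (a + b) c = star a c + star b c.
Proof. exact: (linearD (starl c)). Qed.

Lemma starBl a b c : star (a - b) c = star a c - star b c.
Proof. exact: (linearB (starl c)). Qed.

Lemma starZl x a b : star (x *: a) b = x *: star a b.
Proof. exact: (linearZ_LR (starl b)). Qed.

Lemma star0l b : star 0 b = 0.
Proof. exact: (linear0 (starl b)). Qed.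

Lemma star_binsuml d (f : nat -> V) b :
  star (binsum d f) b = binsum d (fun i => star (f i) b).
Proof.
rewrite -/(starl b _) linear_sum; apply: eq_bigr => i _; exact: starZl.
Qed.

Lemma va_homog_ind (P : V -> Prop) : P 0 ->
  (forall x d a b, va_homog w d a -> P b -> P (x *: a + b)) -> forall a, P a.
Proof.
move=> P0 PD a; elim/in_span_min: (graded a) => // x u v [d hu].
exact: PD hu.
Qed.

Lemma star_assoc a b c : O (star (star a b) c - star a (star b c)).
Proof.
elim/va_homog_ind: a => [|x d a a' ha IH].
  by rewrite !star0l subrr; exact: in_span0.
rewrite !(starDl, starZl) opprD addrACA -scalerBr; apply: in_spanD => //.
apply: in_spanZ; elim/va_homog_ind: b {a' IH} => [|y e b b' hb IH].
  by rewrite linear0 star0l linear0 subrr; exact: in_span0.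
rewrite (linearP (star a)) !(starDl, starZl) (linearP (star a)) /=.
rewrite opprD addrACA -scalerBr; apply: in_spanD => //; apply: in_spanZ.
rewrite !(star_homog _ ha) (star_homog _ hb) star_binsuml.
have := gres_assoc translation 0 c ha hb; rewrite subr0.
congr (O (_ - _)); apply: eq_bigr => j _; congr (_ *: _).
rewrite -star_homog //; apply: va_homog_nprod ha hb _ => //.
by have := ltn_ord j; lia.
Qed.

Lemma star_idealr u c : O u -> O (star u c).
Proof.
elim/in_span_min => [|x _ v [d [a [b [ha ->]]]] IH].
  by rewrite star0l; exact: in_span0.
rewrite starDl starZl; apply: in_spanD => //; apply: in_spanZ.
rewrite /zhu_circ zhu_resE; elim/va_homog_ind: b => [|y e b b' hb IHb].
  by rewrite linear0 star0l; exact: in_span0.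
rewrite linearP starDl starZl; apply: in_spanD => //; apply: in_spanZ.
rewrite star_binsuml; have := gres_circ_star translation c ha hb.
congr (O _); apply: eq_bigr => j _; congr (_ *: _).
rewrite -star_homog //; apply: va_homog_nprod ha hb _ => //.
by have := ltn_ord j; lia.
Qed.

Lemma star_ideall a u : O u -> O (star a u).
Proof.
move=> Ou; elim/va_homog_ind: a => [|x d a a' ha IH].
  by rewrite star0l; exact: in_span0.
rewrite starDl starZl; apply: in_spanD => //; apply: in_spanZ => {a' IH}.
elim/in_span_min: Ou => [|y _ v [e [b [c [hb ->]]]] IH].
  by rewrite linear0; exact: in_span0.
rewrite (linearP (star a)) /=; apply: in_spanD => //; apply: in_spanZ.
rewrite (star_homog _ ha) /zhu_circ zhu_resE.
(* For m = 1 the inner residue has exponent - 2, so it is [zhu_circ] of b and c, and S is a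
   combination of elements of O(V). *)
have := gres_assoc translation 1 c ha hb; rewrite -opprD.
set S := binsum _ _ => as_ab; rewrite -[gres d _ _ _](subKr S).
apply: in_spanB as_ab; apply: in_span_sum => j _; apply: in_spanZ.
have h : va_homog w (d - j + e) (nprod (j%:Z - 1) a b).
  by apply: va_homog_nprod ha hb _ => //; have := ltn_ord j; lia.
by have := gres_circ translation 0 c h; rewrite subr0.
Qed.

Lemma star_vacl b : star (vac V) b = b.
Proof.
by rewrite (star_homog _ (va_homog_vac w)) gresE big_ord1 scale1r nprod_vacl.
Qed.

Lemma star_vacr a : star a (vac V) = a.
Proof.
elim/va_homog_ind: a => [|x d a b ha IH]; first exact: star0l.
by rewrite starDl starZl IH (star_homog _ ha) gres_vac.
Qed.

End ZhuAlgebra.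

(** * The quotient V / O(V) *)

Section ZhuQuotient.
Variables (F : numFieldType) (V : vertexAlgebra F) (w : V).
Hypothesis translation : forall a, nprod 0 w a = va_deriv a.
Hypothesis graded : nat_graded w.
Local Open Scope quotient_scope.

(** The quotient is taken first as an additive group; its product is then induced by [star]. *)
Definition zhu_ideal : {pred V} := fun v => `[< zhu_O w v >].

Lemma zhu_ideal_zmod_closed : zmod_closed zhu_ideal.
Proof.
split=> [|u v]; rewrite !unfold_in; first by apply/asboolP; exact: in_span0.
by move=> /asboolP Ou /asboolP Ov; apply/asboolP; exact: in_spanB.
Qed.

HB.instance Definition _ :=
  GRing.isZmodClosed.Build V zhu_ideal zhu_ideal_zmod_closed.

Definition zhu_quot : zmodType := {ideal_quot zhu_ideal}.

Definition quot_class (v : V) : zhu_quot := \pi_{ideal_quot zhu_ideal} v.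
Definition quot_repr (x : zhu_quot) : V := repr (x : {ideal_quot zhu_ideal}).

Lemma quot_reprK x : quot_class (quot_repr x) = x.
Proof. exact: reprK. Qed.

Lemma quot_classP u v : quot_class u = quot_class v <-> zhu_O w (u - v).
Proof.
rewrite /quot_class; split=> [/eqP|Ouv].
  by rewrite -Quotient.idealrBE => /asboolP.
by apply/eqP; rewrite -Quotient.idealrBE; apply/asboolP.
Qed.

Lemma quot_class_zmod : zmod_morphism quot_class.
Proof. by move=> u v; rewrite /quot_class !piE. Qed.

HB.instance Definition _ :=
  GRing.isZmodMorphism.Build V zhu_quot quot_class quot_class_zmod.

Definition quot_mul x y := quot_class (star graded (quot_repr x) (quot_repr y)).

Lemma quot_mulE u v : quot_mul (quot_class u) (quot_class v) =
  quot_class (star graded u v).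
Proof.
set u' := quot_repr (quot_class u); set v' := quot_repr (quot_class v).
have Ou : zhu_O w (u' - u) by apply/quot_classP; rewrite quot_reprK.
have Ov : zhu_O w (v' - v) by apply/quot_classP; rewrite quot_reprK.
apply/quot_classP; rewrite -/u' -/v'.
(* Each summand has a factor in O(V), which is a two-sided ideal. *)
rewrite (_ : _ - _ = star graded u' (v' - v) + star graded (u' - u) v).
  by apply: in_spanD; [exact: star_ideall | exact: star_idealr].
by rewrite starBl linearB addrA subrK.
Qed.

Lemma quot_mulA : associative quot_mul.
Proof.
move=> x y z; rewrite -(quot_reprK x) -(quot_reprK y) -(quot_reprK z).
by rewrite !quot_mulE; apply/esym/quot_classP; exact: star_assoc.
Qed.

Lemma quot_mul1l : left_id (quot_class (vac V)) quot_mul.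
Proof. by move=> x; rewrite -(quot_reprK x) quot_mulE star_vacl. Qed.

Lemma quot_mul1r : right_id (quot_class (vac V)) quot_mul.
Proof. by move=> x; rewrite -(quot_reprK x) quot_mulE star_vacr. Qed.

Lemma quot_mulDl : left_distributive quot_mul +%R.
Proof.
move=> x y z; rewrite -(quot_reprK x) -(quot_reprK y) -(quot_reprK z).
by rewrite -raddfD !quot_mulE starDl raddfD.
Qed.

Lemma quot_mulDr : right_distributive quot_mul +%R.
Proof.
move=> x y z; rewrite -(quot_reprK x) -(quot_reprK y) -(quot_reprK z).
by rewrite -raddfD !quot_mulE linearD raddfD.
Qed.

Definition zhu_ring : pzRingType :=
  HB.pack zhu_quot (GRing.Zmodule_isPzRing.Build zhu_quot
    quot_mulA quot_mul1l quot_mul1r quot_mulDl quot_mulDr).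

Definition zhu_const (c : F) : zhu_ring := quot_class (c *: vac V).

Lemma zhu_const_zmod : zmod_morphism zhu_const.
Proof. by move=> c d; rewrite /zhu_const scalerBl raddfB. Qed.

Lemma zhu_constM c v :
  zhu_const c * (quot_class v : zhu_ring) = quot_class (c *: v).
Proof. by rewrite [LHS]quot_mulE starZl star_vacl. Qed.

Lemma zhu_const_monoid : monoid_morphism zhu_const.
Proof.
split; first by rewrite /zhu_const scale1r.
by move=> c d; rewrite [RHS]zhu_constM scalerA.
Qed.

Definition zhu_const_rmorph : {rmorphism F -> zhu_ring} :=
  HB.pack zhu_const
    (GRing.isZmodMorphism.Build F zhu_ring zhu_const zhu_const_zmod)
    (GRing.isMonoidMorphism.Build F zhu_ring zhu_const zhu_const_monoid).

Lemma zhu_const_central c (x : zhu_ring) : zhu_const c * x = x * zhu_const c.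
Proof.
by rewrite -(quot_reprK x) zhu_constM [RHS]quot_mulE linearZ /= star_vacr.
Qed.

Lemma zhu_algebra_exists : inhabited (zhu_algebra w).
Proof.
pose A := @PzAlgebra F zhu_ring zhu_const_rmorph zhu_const_central.
exists; apply: (@ZhuAlgebra F V w A quot_class).
- by move=> u v; exact: raddfD.
- by move=> c v; rewrite [RHS]zhu_constM.
- by move=> x; exists (quot_repr x); exact: quot_reprK.
- move=> v; have -> : 0 = quot_class 0 by rewrite raddf0.
  by rewrite quot_classP subr0.
- by move=> d a b ha; rewrite /zhu_star zhu_resE -(star_homog graded _ ha)
    [RHS]quot_mulE.
Qed.

End ZhuQuotient.

(** * Identities in an arbitrary model of the Zhu algebra *)

Section ZhuModel.
Variables (F : numFieldType) (V : vertexAlgebra F) (w : V).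
Hypothesis translation : forall a, nprod 0 w a = va_deriv a.
Variable A : zhu_algebra w.
Implicit Types a b u v : V.
Local Notation cl := (zhu_class A).

Lemma zhu_class0 : cl 0 = 0.
Proof. by apply/zhu_class_ker; exact: in_span0. Qed.

Lemma zhu_classN v : cl (- v) = - cl v.
Proof. by rewrite -scaleN1r zhu_classZ rmorphN1 mulN1r. Qed.

Lemma zhu_classB u v : cl (u - v) = cl u - cl v.
Proof. by rewrite zhu_classD zhu_classN. Qed.

Lemma zhu_class_sum I (r : seq I) (P : pred I) (f : I -> V) :
  cl (\sum_(i <- r | P i) f i) = \sum_(i <- r | P i) cl (f i).
Proof.
by elim/big_ind2: _ => [|u x v y <- <-|//]; rewrite ?zhu_class0 ?zhu_classD.
Qed.

Lemma zhu_class_eq u v : zhu_O w (u - v) -> cl u = cl v.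
Proof. by move=> /(zhu_class_ker A); rewrite zhu_classB => /subr0_eq. Qed.

Lemma zhu_class_gres d a b :
  va_homog w d a -> cl (gres d (- 1) a b) = cl a * cl b.
Proof. exact: zhu_classM. Qed.

Lemma zhu_class_vac : cl (vac V) = 1.
Proof.
(* For a preimage u of 1, [vac] = [vac] [u] = [u]. *)
have [u e] := @zhu_class_surj _ _ _ A 1.
rewrite -[LHS]mulr1 -e -(zhu_class_gres _ (va_homog_vac w)) gresE big_ord1.
by rewrite scale1r nprod_vacl.
Qed.

(** The element [zhu_circ d a vac] of O(V) is a_(- 2) vac + d a_(- 1) vac = D a + d a. *)
Lemma zhu_class_deriv d a : va_homog w d a ->
  cl (va_deriv a) = - (pza_const A d%:R * cl a).
Proof.
move=> ha; rewrite -zhu_classZ -zhu_classN; apply: zhu_class_eq; rewrite opprK.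
have := gres_circ translation 0 (vac V) ha; rewrite subr0 gresE.
case: d ha => [|d] ha.
  by rewrite big_ord1 bin0 !scale1r scale0r addr0.
rewrite !big_ord_recl bin0 scale1r big1 ?addr0 => [|i _].
  by rewrite bin1 nprod_vacr.
by rewrite (_ : _ + _ = i%:Z) ?nprod_vacr0 ?scaler0 // !lift0; lia.
Qed.

(** The case c = [vac] of [gres_commutator], where [gres_vac] collapses each product with the
    vacuum. *)
Lemma zhu_class_commutator d e N a b : va_homog w d a -> va_homog w e b ->
  (forall j : nat, (N <= j)%N -> nprod j%:Z a b = 0) -> (N <= d + e)%N ->
  cl a * cl b - cl b * cl a =
  \sum_(j < N) pza_const A (binz F (d%:Z - 1) j) * cl (nprod j%:Z a b).
Proof.
move=> ha hb abN leN; rewrite -(zhu_class_gres _ ha) -(zhu_class_gres _ hb)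
  -zhu_classB.
under eq_bigr do rewrite -zhu_classZ; rewrite -zhu_class_sum;
  apply: zhu_class_eq.
have := gres_commutator translation (vac V) ha hb abN leN.
by rewrite !gres_vac; under eq_bigr do rewrite gres_vac.
Qed.

End ZhuModel.

(** * Strong generation and the Zhu algebra *)

Section Generation.
Variables (F : numFieldType) (V : vertexAlgebra F) (w : V) (S : V -> Prop).
Hypothesis generated : strongly_generated S.

(** Both w_(0) and D are derivations of all n-th products and kill the vacuum, so agreement on S
    propagates. *)
Lemma translation_generated :
  (forall s, S s -> nprod 0 w s = va_deriv s) ->
  forall a, nprod 0 w a = va_deriv a.
Proof.
move=> trS a; elim/in_span_min: (generated a) => [|x u v mu IH].
  by rewrite !linear0.
rewrite !linearP /= IH; congr (_ *: _ + _); elim: mu => [|s b n Ss _ {}IH].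
  by rewrite (nprod_vacr0 0) /va_deriv nprod_vacl.
by rewrite nprod0_commutator deriv_nprod trS // IH.
Qed.

Hypothesis translation : forall a, nprod 0 w a = va_deriv a.
Hypothesis homogS : forall s, S s -> exists2 d, (0 < d)%N & va_homog w d s.

Lemma strong_monomial_homog v : strong_monomial S v -> exists d, va_homog w d v.
Proof.
elim=> [|s b n Ss _ [e he]]; first by exists 0%N; exact: va_homog_vac.
have [d _ hd] := homogS Ss; exists (d + e + n)%N.
by apply: va_homog_nprod hd he _ => //; lia.
Qed.

Lemma nat_graded_generated : nat_graded w.
Proof.
move=> v; elim/in_span_min: (generated v) => [|x s u ms IH].
  exact: in_span0.
by apply: in_spanD => //; apply: in_spanZ; apply: in_span_gen;
  exact: strong_monomial_homog.
Qed.

Lemma va_homog_unique d e a :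
  va_homog w d a -> va_homog w e a -> d != e -> a = 0.
Proof.
rewrite /va_homog => -> /eqP; rewrite -subr_eq0 -scalerBl scaler_eq0 subr_eq0
  eqr_nat.
by case/orP=> [->|/eqP].
Qed.

(* f is the product of the (L(0) - d) / (N - d) over the d < M other than N. *)
Lemma homog_projector N M : exists f : V -> V, [/\ linear f,
  forall d a, va_homog w d a -> va_homog w d (f a),
  forall a, va_homog w N a -> f a = a &
  forall d a, (d < M)%N -> d != N -> va_homog w d a -> f a = 0].
Proof.
elim: M => [|M [f [lf hf fN f0]]]; first by exists id; split.
have [MN|MN] := eqVneq M N.
  exists f; split=> // d a; rewrite ltnS leq_eqVlt => /orP[/eqP->|].
    by rewrite MN eqxx.
  exact: f0.
exists (fun a => (N%:R - M%:R)^-1 *: (nprod 1 w (f a) - M%:R *: f a)).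
have nz : N%:R - M%:R != 0 :> F by rewrite subr_eq0 eqr_nat eq_sym.
split=> [x a b|d a ha|a ha|d a].
- rewrite lf linearP [X in _ = X + _]scalerA (mulrC x) -scalerA -scalerDr.
  by congr (_ *: _); rewrite scalerBr scalerDr !scalerA (mulrC x) opprD addrACA.
- have hfa := hf _ _ ha; rewrite (hfa : nprod 1 w (f a) = _) -scalerBl.
  by do 2!apply: va_homogZ.
- by rewrite fN // ha -scalerBl scalerA mulVf // scale1r.
rewrite ltnS leq_eqVlt => /orP[/eqP-> _|dM dN] ha.
  by rewrite (hf _ _ ha : nprod 1 w (f a) = _) subrr scaler0.
by rewrite (f0 d) // linear0 scaler0 subrr scaler0.
Qed.

(** The projector onto degree N fixes u and kills the terms of its expansion that have another
    degree. *)
Lemma homog_component N n (c : 'I_n -> F) (s : 'I_n -> V) (e : 'I_n -> nat) u :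
  va_homog w N u -> (forall i, va_homog w (e i) (s i)) ->
  u = \sum_i c i *: s i -> u = \sum_(i | e i == N) c i *: s i.
Proof.
move=> hu hs eu.
have [f [lf _ fN f0]] := homog_projector N (\max_i (e i)).+1.
have f00 : f 0 = 0 by have := lf (- 1) 0 0;
  rewrite !scaler0 addr0 scaleN1r addNr.
rewrite -(fN _ hu) {1}eu.
rewrite (big_morph f (id1 := 0) (op1 := +%R)) => [|x y|//]; last first.
  by have := lf 1 x y; rewrite !scale1r.
rewrite [RHS]big_mkcond; apply: eq_bigr => i _.
have -> : f (c i *: s i) = c i *: f (s i).
  by have := lf (c i) (s i) 0; rewrite f00 !addr0.
case: eqP => [eN|/eqP eN]; first by rewrite fN // -eN.
by rewrite (f0 (e i)) ?scaler0 // ltnS leq_bigmax.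
Qed.

Variables (A : zhu_algebra w) (P : A -> Prop).
Hypothesis PD : forall x y, P x -> P y -> P (x + y).
Hypothesis PM : forall x y, P x -> P y -> P (x * y).
Hypothesis PC : forall c, P (pza_const A c).
Hypothesis PS : forall s, S s -> P (zhu_class A s).

(* Induction on the degree: modulo O(V) and lower degrees, s_(-n-1) v vanishes
   for n > 0, and s_(-1) v is the product of s and v. *)
Lemma zhu_class_generated v : P (zhu_class A v).
Proof.
have P0 : P 0 by rewrite -(rmorph0 (pza_const A)).
have PZ c u : P (zhu_class A u) -> P (zhu_class A (c *: u)).
  by move=> Pu; rewrite zhu_classZ; exact: PM.
have Psum I (r : seq I) (Q : pred I) (f : I -> V) :
    (forall i, Q i -> P (zhu_class A (f i))) ->
    P (zhu_class A (\sum_(i <- r | Q i) f i)).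
  by move=> Pf; rewrite zhu_class_sum; apply: big_ind.
suff Phom N u : va_homog w N u -> P (zhu_class A u).
  elim/in_span_min: (generated v) => [|x s u ms IH];
    first by rewrite zhu_class0.
  rewrite zhu_classD; apply: (PD) => //; apply: (PZ).
  by have [d] := strong_monomial_homog ms; exact: Phom.
have [M] := ubnP N; elim: M N u => // M IH N u NM hu.
have [n [c [s [ms eu]]]] := generated u.
have [e he] := choice (fun i => strong_monomial_homog (ms i)).
(* The expansion of u may contain monomials of degree above N, out of reach of the induction; they
   are discarded. *)
rewrite (homog_component hu he eu); apply: (Psum) => i /eqP eN; apply: (PZ).
have := he i; rewrite eN; case: (ms i) => [|a b m Sa mb] hab.
  by rewrite zhu_class_vac -(rmorph1 (pza_const A)).
have [d d0 ha] := homogS Sa; have [q hb] := strong_monomial_homog mb.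
(* If d + q + m differs from N, the monomial has two degrees and is zero. *)
have [dN|dN] := eqVneq (d + q + m)%N N; last first.
  rewrite (va_homog_unique _ hab dN) ?zhu_class0 //.
  by apply: va_homog_nprod ha hb _ => //; lia.
(* For m = 0 this class is [a] [b], and q < N because d > 0; for m > 0 the residue is in O(V). *)
have : P (zhu_class A (gres d (- m.+1%:Z) a b)).
  case: m dN {hab} => [|m] dN.
    by rewrite (zhu_class_gres A _ ha); apply: (PM);
      [exact: PS | apply: IH hb; lia].
  rewrite (_ : - _ = - 2%:Z - m%:Z); last by lia.
  by rewrite (zhu_class_eq A (v := 0)) ?zhu_class0 // subr0; exact: gres_circ.
rewrite gresE big_ord_recl bin0 scale1r add0r zhu_classD => Pab.
set x := zhu_class A (nprod _ _ _) in Pab *.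
set y := zhu_class A _ in Pab.
(* The remaining terms a_(j - m) b have degree N - j - 1, smaller than N. *)
have Py : P y.
  apply: (Psum) => j _; apply: (PZ); apply: (IH (N - j.+1)%N).
    by lia.
  apply: va_homog_nprod ha hb _ => //; rewrite lift0.
  by have := ltn_ord j; lia.
rewrite -[x](addrK y); apply: (PD) => //.
by rewrite -mulN1r -(rmorphN1 (pza_const A)); exact: PM.
Qed.

End Generation.

(** * Algebras satisfying the Smith relations *)

Section SmithMorphism.
Variables (F : fieldType) (A : pzAlgebra F) (g : {poly {poly F}}).
Variables (E Fm X Y : A).
Local Notation cst := (pza_const A).

Fixpoint smith_val (t : smith_term F) : A :=
  match t with
  | STE => E | STF => Fm | STX => X | STY => Y
  | STC c => cst c
  | STadd s t => smith_val s + smith_val t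
  | STmul s t => smith_val s * smith_val t
  end.

Lemma smith_val_exp t n : smith_val (STexp t n) = smith_val t ^+ n.
Proof. by elim: n => [|n IH] /=; rewrite ?rmorph1 // exprS -IH. Qed.

Lemma smith_val_sub s t : smith_val (STsub s t) = smith_val s - smith_val t.
Proof. by rewrite /= rmorphN1 mulN1r. Qed.

(** Summation over a fixed rectangle replaces the bounds that depend on g; the added coefficients
    are zero. *)
Lemma smith_val_eval m n : (size g <= m)%N ->
  (forall i, (size (g`_i)%R <= n)%N) ->
  smith_val (smith_eval g) =
  \sum_(i < m) \sum_(j < n) cst g`_i`_j * (X ^+ i * Y ^+ j).
Proof.
have val0 : smith_val (STC 0) = 0 by rewrite /= rmorph0.
move=> gm gn; rewrite /smith_eval (big_morph smith_val (fun _ _ => erefl) val0).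
rewrite (big_ord_widen m (fun i => smith_val
   (\big[STadd (F:=F)/STC 0]_(j < size g`_i)
     STmul (STC g`_i`_j) (STmul (STexp (STX F) i) (STexp (STY F) j)))) gm).
rewrite big_mkcond; apply: eq_bigr => i _.
case: ltnP => [_|gi]; last first.
  by rewrite nth_default // big1 // => j _; rewrite coef0 rmorph0 mul0r.
rewrite (big_morph smith_val (fun _ _ => erefl) val0).
rewrite (big_ord_widen n (fun j => smith_val
   (STmul (STC g`_i`_j) (STmul (STexp (STX F) i) (STexp (STY F) j)))) (gn i)).
rewrite big_mkcond; apply: eq_bigr => j _.
case: ltnP => [_|gj]; first by rewrite /= !smith_val_exp.
by rewrite (nth_default _ gj) rmorph0 mul0r.
Qed.

Hypothesis XE : X * E - E * X = E.
Hypothesis XF : X * Fm - Fm * X = - Fm.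
Hypothesis EF : E * Fm - Fm * E = smith_val (smith_eval g).
Hypothesis YE : Y * E = E * Y.
Hypothesis YF : Y * Fm = Fm * Y.
Hypothesis YX : Y * X = X * Y.

Lemma smith_val_cong s t : smith_cong g s t -> smith_val s = smith_val t.
Proof.
elim=> {s t} /=.
- by [].
- by move=> s t _ ->.
- by move=> s t u _ -> _ ->.
- by move=> s s' t t' _ -> _ ->.
- by move=> s s' t t' _ -> _ ->.
- by move=> s t u; rewrite addrA.
- by move=> s t; rewrite addrC.
- by move=> t; rewrite rmorph0 add0r.
- by move=> t; rewrite rmorphN1 mulN1r addNr rmorph0.
- by move=> s t u; rewrite mulrA.
- by move=> t; rewrite rmorph1 mul1r.
- by move=> s t u; rewrite mulrDl.
- by move=> s t u; rewrite mulrDr.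
- by move=> c d; rewrite rmorphD.
- by move=> c d; rewrite rmorphM.
- by move=> c t; rewrite pza_const_central.
- by rewrite rmorphN1 mulN1r.
- by rewrite rmorphN1 !mulN1r.
- by rewrite rmorphN1 mulN1r.
- exact: YE.
- exact: YF.
- exact: YX.
Qed.

(** By [smith_val_cong] the value does not depend on the representative. *)
Definition smith_lift (x : smith_algebra g) : A := smith_val (smith_repr x).

Lemma smith_lift_class t : smith_lift (smith_class g t) = smith_val t.
Proof. by apply: smith_val_cong; exact: smith_repr_class. Qed.

Lemma smith_lift_zmod : zmod_morphism smith_lift.
Proof.
elim/smith_ind=> s; elim/smith_ind=> t.
have -> : smith_class g s - smith_class g t = smith_class g (STsub s t).
  by rewrite [LHS]/GRing.add /= /GRing.opp /= smith_oppE smith_addE.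
by rewrite !smith_lift_class smith_val_sub.
Qed.

Lemma smith_lift_monoid : monoid_morphism smith_lift.
Proof.
split; first by rewrite [LHS]smith_lift_class /= rmorph1.
elim/smith_ind=> s; elim/smith_ind=> t.
have -> : smith_class g s * smith_class g t = smith_class g (STmul s t).
  by rewrite [LHS]/GRing.mul /= smith_mulE.
by rewrite !smith_lift_class.
Qed.

Definition smith_rmorphism : {rmorphism smith_algebra g -> A} :=
  HB.pack smith_lift
    (GRing.isZmodMorphism.Build _ _ smith_lift smith_lift_zmod)
    (GRing.isMonoidMorphism.Build _ _ smith_lift smith_lift_monoid).

Lemma smith_quotient : (forall y : A, exists t, smith_val t = y) ->
  is_quotient_algebra (smith_algebra g) A.
Proof.
move=> surj; exists smith_rmorphism; split=> [c|y].
  exact: (smith_lift_class (STC c)).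
by have [t <-] := surj y; exists (smith_class g t); exact: smith_lift_class.
Qed.

End SmithMorphism.

Lemma bp_poly_val (F : fieldType) (A : pzAlgebra F) (E G X Y : A) (k : F) :
  smith_val E G X Y (smith_eval (bp_poly k)) =
  - (pza_const A 3%:R * (X * X) - pza_const A (2%:R * k + 3%:R) * X
     - pza_const A (k + 3%:R) * Y).
Proof.
have cf i j : (bp_poly k)`_i`_j =
   - (3%:R * ((i == 2) && (j == 0))%:R
      - (2%:R * k + 3%:R) * ((i == 1) && (j == 0))%:R
      - (k + 3%:R) * ((i == 0) && (j == 1))%:R).
  rewrite /bp_poly !(coefN, coefB, coefZ, coefXn, coefX, coefC, coefCM).
  by case: i j => [|[|[|i]]] [|[|j]]; rewrite /=
    !(mulr0, mulr1, coef0, coef1, coefC, coefX, coefMn) //= ?mul0rn ?subr0.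
have g3 : (size (bp_poly k) <= 3)%N.
  apply/leq_sizeP => -[|[|[|i]]] // _; apply/polyP => j.
  by rewrite cf coef0 /= !mulr0 !subr0 oppr0.
rewrite (smith_val_eval _ _ _ _ g3 (n := 2)) => [|i]; last first.
  by apply/leq_sizeP => -[|[|j]] // _; rewrite cf !andbF !mulr0 !subr0 oppr0.
rewrite !big_ord_recl !big_ord0 /= !cf /= /bump /= !addn0 !addr0.
rewrite !mulr0 !mulr1 !subr0 !sub0r !opprK !oppr0 !rmorph0 !mul0r !add0r !addr0.
by rewrite !mul1r ?expr0 ?mulr1 rmorphN mulNr [RHS]opprB opprB.
Qed.

(** * The Bershadsky-Polyakov algebra *)

Section BershadskyPolyakov.
Variables (F : numFieldType) (k : F) (W : vertexAlgebra F) (J T Gp Gm : W).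
Hypothesis k_neq : k != - 3%:R.
Hypothesis bp : bp_ope k J T Gp Gm.
Hypothesis gen : strongly_generated
    (fun a : W => [\/ a = J, a = T, a = Gp | a = Gm]).

Let w : W := T + 2%:R^-1 *: va_deriv J.

(** In terms of modes this is L(n - 1) = L_(n - 1) - (n / 2) J_(n - 1), from (D J)_(n) = - n J_(n -
    1). *)
Lemma bp_omegaE n a :
  nprod n w a = nprod n T a - (n%:~R / 2%:R) *: nprod (n - 1) J a.
Proof.
by rewrite nprodDl nprodZl nprod_deriv scalerA mulrN mulrC scaleNr.
Qed.

Lemma bp_translation a : nprod 0 w a = va_deriv a.
Proof.
apply: (translation_generated gen) => s; rewrite bp_omegaE mul0r scale0r subr0.
have h := (bp_TJ bp 0, bp_TT bp 0, bp_TGp bp 0, bp_TGm bp 0).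
by case=> ->; rewrite h.
Qed.

Lemma bp_homog_J : va_homog w 1 J.
Proof.
by rewrite /va_homog bp_omegaE (bp_TJ bp 1) (bp_JJ bp 0) scaler0 subr0 scale1r.
Qed.

Lemma bp_homog_Gp : va_homog w 1 Gp.
Proof.
rewrite /va_homog bp_omegaE (bp_TGp bp 1) (bp_JGp bp 0) /= -scalerBl.
by congr (_ *: _); field.
Qed.

Lemma bp_homog_Gm : va_homog w 2 Gm.
Proof.
rewrite /va_homog bp_omegaE (bp_TGm bp 1) (bp_JGm bp 0) /= scalerN opprK
  -scalerDl.
by congr (_ *: _); field.
Qed.

(** The vanishing starts at 3, because w_(2) J = - J_(1) J is a multiple of the vacuum. *)
Lemma bp_omega_J (n : nat) : nprod n.+3%:Z w J = 0.
Proof.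
rewrite bp_omegaE (bp_TJ bp n.+3) (_ : _ - 1 = n.+2%:Z); last by lia.
by rewrite (bp_JJ bp n.+2) /= !nth_nil scaler0 subr0.
Qed.

Lemma bp_omega_Gp (n : nat) : nprod n.+2%:Z w Gp = 0.
Proof.
rewrite bp_omegaE (bp_TGp bp n.+2) (_ : _ - 1 = n.+1%:Z); last by lia.
by rewrite (bp_JGp bp n.+1) /= !nth_nil scaler0 subr0.
Qed.

Lemma bp_omega_Gm (n : nat) : nprod n.+2%:Z w Gm = 0.
Proof.
rewrite bp_omegaE (bp_TGm bp n.+2) (_ : _ - 1 = n.+1%:Z); last by lia.
by rewrite (bp_JGm bp n.+1) /= !nth_nil scaler0 subr0.
Qed.

(** Substituting T = w - D J / 2 makes the coefficient of D J equal to 3 (k + 1) / 2 + (k + 3) / 2 =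
    2 k + 3. *)
Lemma bp_GpGm0 : nprod 0 Gp Gm =
  3%:R *: nprod (- 1) J J + (2%:R * k + 3%:R) *: va_deriv J - (k + 3%:R) *: w.
Proof.
rewrite (bp_GpGm bp 0) /= /w scalerDr opprD -!addrA; congr (_ + _).
rewrite [LHS]addrC [RHS]addrCA scalerA -scalerBl; congr (_ + _ *: _).
by field.
Qed.

(* The OPE of J with T is not given; as k <> - 3, T is read off G+_(0) G-. *)
Lemma bp_homog_T : va_homog w 2 T.
Proof.
have k3 : k + 3%:R != 0 by rewrite addr_eq0.
have := bp_GpGm bp 0; rewrite /= => e.
have -> : T = (k + 3%:R)^-1 *: (3%:R *: nprod (- 1) J J
    + (3%:R * (k + 1) / 2%:R) *: va_deriv J - nprod 0 Gp Gm).
  by rewrite [nprod 0 _ _]e subKr scalerK.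
have hN t a : va_homog w t a -> va_homog w t (- a).
  by rewrite -scaleN1r; exact: va_homogZ.
have tr := bp_translation.
apply: va_homogZ; apply: va_homogD; first apply: va_homogD;
  try apply: va_homogZ.
- by apply: (va_homog_nprod tr bp_homog_J bp_homog_J).
- by apply: (va_homog_deriv tr bp_homog_J).
- by apply: hN => //; apply: (va_homog_nprod tr bp_homog_Gp bp_homog_Gm).
Qed.

Lemma bp_homog_generators s : [\/ s = J, s = T, s = Gp | s = Gm] ->
  exists2 d, (0 < d)%N & va_homog w d s.
Proof.
case=> ->; [exists 1%N|exists 2%N|exists 1%N|exists 2%N] => //.
- exact: bp_homog_J.
- exact: bp_homog_T.
- exact: bp_homog_Gp.
- exact: bp_homog_Gm.
Qed.

Lemma bp_homog_omega : va_homog w 2 w.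
Proof.
apply: va_homogD; first exact: bp_homog_T.
by apply: va_homogZ; apply: va_homog_deriv bp_homog_J; exact: bp_translation.
Qed.

Lemma bp_nat_graded : nat_graded w.
Proof. exact: nat_graded_generated gen bp_translation bp_homog_generators. Qed.

Variable A : zhu_algebra w.
Local Notation cl := (zhu_class A).

Lemma bp_omega_central d a : va_homog w d a -> (0 < d)%N ->
  (forall j : nat, (3 <= j)%N -> nprod j%:Z w a = 0) ->
  cl w * cl a = cl a * cl w.
Proof.
move=> ha d0 wa; apply/eqP; rewrite -subr_eq0.
rewrite (zhu_class_commutator bp_translation A bp_homog_omega ha wa) ?addSn //.
rewrite !big_ord_recl big_ord0 /= /bump /=.
(* As w has degree 2, the coefficients C(1, j) are 1, 1, 0: only w_(0) a and w_(1) a contribute. *)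
rewrite (_ : 2%:Z - 1 = 1) // !addn0 binz0 binz1 binz1l.
rewrite (rmorph0 (pza_const A)) mul0r !addr0 rmorph1 mul1r rmorph1 mul1r.
rewrite bp_translation (zhu_class_deriv bp_translation A ha).
by rewrite (ha : nprod 1 w a = _) zhu_classZ addNr.
Qed.

Lemma bp_quotient : is_quotient_algebra (smith_algebra (bp_poly k)) A.
Proof.
have tr := bp_translation.
have bin0z : binz F (1%:Z - 1) 0 = 1 by rewrite binz0.
apply: (@smith_quotient _ _ _ (cl Gp) (- cl Gm) (cl J) (cl w)).
- rewrite (@zhu_class_commutator _ _ _ tr A 1 1 1 _ _
    bp_homog_J bp_homog_Gp) //.
    by rewrite big_ord1 bin0z rmorph1 mul1r (bp_JGp bp 0).
  by case=> // j _; rewrite (bp_JGp bp j.+1) /= nth_nil.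
- rewrite mulrN mulNr -opprD; congr (- _).
  rewrite (@zhu_class_commutator _ _ _ tr A 1 2 1 _ _
    bp_homog_J bp_homog_Gm) //.
    by rewrite big_ord1 bin0z rmorph1 mul1r (bp_JGm bp 0) zhu_classN.
  by case=> // j _; rewrite (bp_JGm bp j.+1) /= nth_nil.
- rewrite bp_poly_val mulrN mulNr -opprD; congr (- _).
  rewrite (@zhu_class_commutator _ _ _ tr A 1 2 3 _ _
    bp_homog_Gp bp_homog_Gm) //.
    (* As G+ has degree 1, the coefficients C(0, j) leave only G+_(0) G-. *)
    rewrite big_ord_recl big1 ?addr0 => [|j _]; last first.
      by rewrite lift0 subrr binz0l rmorph0 mul0r.
    rewrite bin0z rmorph1 mul1r bp_GpGm0 zhu_classB zhu_classD !zhu_classZ.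
    rewrite (zhu_class_deriv tr A bp_homog_J) rmorph1 mul1r mulrN.
    congr (_ * _ - _ - _).
    (* As J has degree 1 and J_(0) J = 0, the square of [J] is the class of J_(- 1) J. *)
    rewrite -(zhu_class_gres A _ bp_homog_J) gresE !big_ord_recl big_ord0
      !addr0 /= !scale1r.
    by rewrite (bp_JJ bp 0) addr0.
  by move=> [|[|[|j]]] // _; rewrite (bp_GpGm bp j.+3) /= nth_nil.
- apply: bp_omega_central bp_homog_Gp _ _ => // -[|[|j]] // _;
    exact: bp_omega_Gp.
- rewrite mulrN mulNr; congr (- _).
  apply: bp_omega_central bp_homog_Gm _ _ => // -[|[|j]] // _;
    exact: bp_omega_Gm.
- apply: bp_omega_central bp_homog_J _ _ => // -[|[|[|j]]] // _;
    exact: bp_omega_J.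
move=> y; have [v <-] := zhu_class_surj y.
(* The values of terms form a subalgebra, so it suffices to reach the classes of the four
   generators. *)
apply: (zhu_class_generated gen tr bp_homog_generators
  (P := fun y => exists t, smith_val _ _ _ _ t = y)).
- by move=> _ _ [s <-] [t <-]; exists (STadd s t).
- by move=> _ _ [s <-] [t <-]; exists (STmul s t).
- by move=> c; exists (STC c).
move=> s; case=> ->.
- by exists (STX F).
(* [T] = Y + X / 2, since T = w - D J / 2 and [D J] = - [J]. *)
- exists (STadd (STY F) (STmul (STC 2%:R^-1) (STX F))) => /=.
  rewrite -zhu_classZ -zhu_classD.
  have -> : T = w - 2%:R^-1 *: va_deriv J by rewrite addrK.
  rewrite zhu_classB zhu_classZ (zhu_class_deriv tr A bp_homog_J) rmorph1 mul1r.
  by rewrite mulrN opprK zhu_classD zhu_classZ.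
- by exists (STE F).
- by exists (STmul (STC (-1)) (STF F)); rewrite /= rmorphN1 mulN1r opprK.
Qed.

End BershadskyPolyakov.

Theorem proposition4p2 (R : realType) (k : R[i]) (hk : k != - 3%:R)
    (W : vertexAlgebra R[i]) (J T Gp Gm : W)
    (hW : is_universal_bp k J T Gp Gm) :
  let omega_bar : W := T + 2%:R^-1 *: va_deriv J in
  [/\ nat_graded omega_bar,
      inhabited (zhu_algebra omega_bar) &
      forall A : zhu_algebra omega_bar,
        is_quotient_algebra (smith_algebra (bp_poly k)) A].
Proof.
move=> w; have [bp gen _] := hW.
have graded : nat_graded w := bp_nat_graded hk bp gen.
split=> //; first exact: zhu_algebra_exists (bp_translation bp gen) graded.
move=> A; exact: (bp_quotient hk bp gen A).
Qed.
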